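(* Let $V$ be a $\mathbb Z_2$-graded complex vector space of superdimension $(m|n)$, let $U=V\otimes_{\mathbb C}\Lambda$ with $\Lambda$ the infinite-dimensional Grassmann algebra, and let $W=\bigoplus_{i=1}^sU_{b_i}^{t_i}$ with $s\in\mathbb N$ and non-negative integers $t_i,b_i$. Let $(m_1,\dots,m_s)$ be non-negative integers with $\sum_km_kt_k=\sum_km_kb_k=N$, let $r=\sum_im_i$, and let $\sigma\in\mathfrak S_N$. Then the graded picture invariant $\varphi_\sigma\in S^{(m_1,\dots,m_s)}(W^* )$ is mapped by the restitution map $F^r$ to the function on $W_0$ given by $$F^r(\varphi_\sigma)(u_1,\dots,u_s)=T_\sigma\big(\underbrace{u_1\otimes\cdots\otimes u_1}_{m_1}\otimes\cdots\otimes\underbrace{u_s\otimes\cdots\otimes u_s}_{m_s}\big)$$ for all $(u_1,\dots,u_s)\in W_0$.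
   Context: **Setting.** $\Lambda=\varinjlim\Lambda(k)$ is the complex Grassmann (exterior) algebra on countably many generators, with its $\mathbb Z_2$-grading; one-sided $\Lambda$-modules are bimodules by supercommutativity. $V=V_0\oplus V_1$ has a basis $e_1,\dots,e_{m+n}$, with the first $m$ vectors even and the last $n$ odd, and dual basis $e_1^*,\dots,e_{m+n}^*$, also regarded as $\Lambda$-bases of $U$ and $U^*=\operatorname{Hom}_\Lambda(U,\Lambda)$. All tensor products of $\Lambda$-modules are over $\Lambda$; $|x|$ is the parity of $x$; $U_b^t:=U^{\otimes b}\otimes(U^* )^{\otimes t}$. $W_0$ is the even part of the $\mathbb Z_2$-graded module $W$. **Supersymmetric algebra.** $T^r(W^* )=(W^* )^{\otimes r}$ and $S(W^* )=T(W^* )/I(W^* )$, where $I(W^* )$ is generated by $u\otimes v-(-1)^{|u||v|}v\otimes u$ for homogeneous $u,v\in W^*$. $\varpi_r:T^r(W^* )\to S^r(W^* )$ is the quotient map. $T(i)_{l_1\cdots l_{b_i}}^{u_1\cdots u_{t_i}}\in(U_{b_i}^{t_i})^*\subset W^*$ is the dual basis element which is $1$ on $e_{l_1}\otimes\cdots\otimes e_{l_{b_i}}\otimes e^*_{u_1}\otimes\cdots\otimes e^*_{u_{t_i}}$ and $0$ on the other standard basis vectors. It has multidegree the $i$-th standard unit vector of $\mathbb Z^s$, and $S^{(m_1,\dots,m_s)}(W^* )$ is the multidegree $(m_1,\dots,m_s)$ component of $S^r(W^* )$, $r=\sum m_i$. **Restitution.** The evaluation $ev:T^r(W^* )\otimes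 T^r(W)\to\Lambda$ is given by $ev(f_1\otimes\cdots\otimes f_r\otimes w_1\otimes\cdots\otimes w_r)=(-1)^{p}f_1(w_1)\cdots f_r(w_r)$, $p=\sum_{j}|w_j|(|f_{j+1}|+\cdots+|f_r|)$, for homogeneous $f_j,w_j$. $\mathcal F(W_0,\Lambda)$ is the $\Lambda$-module of functions $W_0\to\Lambda$. For $f\in S^r(W^* )$, $F^r(f)\in\mathcal F(W_0,\Lambda)$ is $F^r(f)(w)=ev(\boldsymbol f\otimes w\otimes\cdots\otimes w)$, where $\boldsymbol f\in T^r(W^* )$ is any element with $\varpi_r(\boldsymbol f)=f$ (this is independent of the choice). **Graded picture invariants.** For $1\le i\le s$, $1\le j\le m_i$ put $B(i,j)=\sum_{p<i}m_pb_p+(j-1)b_i$ and $C(i,j)=\sum_{p<i}m_pt_p+(j-1)t_i$. Then $$\varphi_\sigma=\sum_{r_1,\dots,r_N\in\{1,\dots,m+n\}}\gamma\,(-1)^{q}\prod_{i=1}^s\prod_{j=1}^{m_i}T(i)_{r_{\sigma(B(i,j)+1)}\cdots r_{\sigma(B(i,j)+b_i)}}^{r_{C(i,j)+1}\cdots r_{C(i,j)+t_i}},$$ with the product in the order $(1,1),\dots,(1,m_1),(2,1),\dots,(s,m_s)$, where, with $a_k$ the parity of $e_{r_k}$, $$\gamma=\prod_{\substack{1\le k<l\le N\\ \sigma(k)>\sigma(l)}}(-1)^{a_{\sigma(k)}a_{\sigma(l)}},$$ $$q=\sum_{i=1}^s\sum_{j=1}^{m_i}\Big(\sum_{l=1}^{b_i}a_{\sigma(B(i,j)+l)}\Big)\Big(\sum_{k=1}^{C(i,j)}a_k\Big)+\sum_{k=1}^Na_k+\sum_{1\le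 k<l\le N}a_ka_l+\sum_{(i,j)<(i',j')}d_{i,j}d_{i',j'},$$ and $d_{i,j}=\sum_{l=1}^{b_i}a_{\sigma(B(i,j)+l)}+\sum_{k=1}^{t_i}a_{C(i,j)+k}$. **The linear map $T_\sigma$.** $T_\sigma:\bigotimes_{i=1}^s(U_{b_i}^{t_i})^{\otimes m_i}\to\Lambda$ is the composite of the following maps, where every permutation of tensor factors carries the usual sign (interchanging adjacent homogeneous factors $x,y$ gives the sign $(-1)^{|x||y|}$): 1. ($\mu$) the rearrangement $\bigotimes_{i}(U_{b_i}^{t_i})^{\otimes m_i}\to U^{\otimes N}\otimes(U^* )^{\otimes N}$ moving all $U$-factors to the left of all $U^*$-factors, preserving the order among the $U$-factors and among the $U^*$-factors; 2. ($\hat\sigma$) the action of $\sigma$ on $U^{\otimes N}$, $v_1\otimes\cdots\otimes v_N\mapsto\pm v_{\sigma^{-1}(1)}\otimes\cdots\otimes v_{\sigma^{-1}(N)}$, tensored with the identity on $(U^* )^{\otimes N}$; 3. ($\tau$) the rearrangement $U^{\otimes N}\otimes(U^* )^{\otimes N}\to(U\otimes U^* )^{\otimes N}$, $v_1\otimes\cdots\otimes v_N\otimes f_1\otimes\cdots\otimes f_N\mapsto\pm v_1\otimes f_1\otimes\cdots\otimes v_N\otimes f_N$; 4. ($\nu$) the interchange of the two factors in each $U\otimes U^*$, giving an element of $(U^*\otimes U)^{\otimes N}$; 5. the evaluation $f_1\otimes v_1\otimes\cdots\otimes f_N\otimes v_N\mapsto f_1(v_1)\cdots f_N(v_N)$.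 *)

(* Defs.v *)
From HB Require Import structures.
From mathcomp Require Import all_boot perm ssralg complex.
From mathcomp Require Import generic_quotient ring_quotient.
From mathcomp Require Import finmap monalg boolp classical_sets reals.

Set Implicit Arguments.
Unset Strict Implicit.
Unset Printing Implicit Defensive.

Import GRing.Theory.
Local Open Scope ring_scope.

Section MalgExtra.
Variables (K : choiceType) (G : zmodType).
Implicit Types f g h : {malg G[K]}.

Lemma malg_ind (P : {malg G[K]} -> Prop) :
  P 0 -> (forall f g, P f -> P g -> P (f + g)) ->
  (forall k x, P << x *g k >>) -> forall f, P f.
Proof. by move=> P0 PD PU f; rewrite (monalgE f); elim/big_ind: _ => // k _; apply: PU. Qed.

Lemma big_msuppw (V : zmodType) (F : K -> G -> V) (d : {fset K}) f :
  (forall k, F k 0 = 0) -> (msupp f `<=` d)%fset ->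
  \sum_(k <- msupp f) F k f@_k = \sum_(k <- d) F k f@_k.
Proof.
move=> F0 sfd; apply: big_fset_incl => // k _ kf.
by rewrite mcoeff_outdom.
Qed.

Variables (V : zmodType) (F : K -> G -> V).
Hypothesis FD : forall k, {morph F k : x y / x + y}.

Let F0 k : F k 0 = 0.
Proof. by apply: (@addIr _ (F k 0)); rewrite -FD !add0r. Qed.

Definition mext f := \sum_(k <- msupp f) F k f@_k.

Lemma mextD : {morph mext : f g / f + g}.
Proof.
move=> f g; rewrite /mext.
rewrite !(@big_msuppw _ F (msupp f `|` msupp g)%fset) //.
- by rewrite -big_split /=; apply: eq_bigr => k _; rewrite mcoeffD FD.
- exact: fsubsetUr.
- exact: fsubsetUl.
- exact: msuppD_le.
Qed.

Lemma mextU k x : mext << x *g k >> = F k x.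
Proof.
rewrite /mext (@big_msuppw _ F [fset k]%fset) ?msuppU_le //.
by rewrite big_seq_fset1 mcoeffUU.
Qed.

End MalgExtra.

Section MalgMul.
Variables (K : choiceType) (G : zmodType) (M : K -> G -> K -> G -> {malg G[K]}).
Hypothesis MDl : forall k l y, {morph (fun x => M k x l y) : x y / x + y}.
Hypothesis MDr : forall k x l, {morph M k x l : x y / x + y}.
Implicit Types f g h : {malg G[K]}.

Definition malg_mul f g : {malg G[K]} :=
  \sum_(k <- msupp f) \sum_(l <- msupp g) M k f@_k l g@_l.

Let L g k x := mext (M k x) g.
Let LD g k : {morph L g k : x y / x + y}.
Proof. by move=> x y; rewrite /L /mext -big_split /=; apply: eq_bigr => l _; rewrite MDl. Qed.

Lemma malg_mulDl : left_distributive malg_mul +%R.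
Proof. by move=> f g h; apply: (mextD (LD h)). Qed.

Lemma malg_mulDr : right_distributive malg_mul +%R.
Proof.
move=> f g h; rewrite /malg_mul -big_split /=; apply: eq_bigr => k _.
exact: (mextD (MDr k f@_k)).
Qed.

Lemma malg_mulUU k x l y : malg_mul << x *g k >> << y *g l >> = M k x l y.
Proof. by rewrite [LHS](mextU (LD _)) /L mextU. Qed.

Lemma malg_mul0l f : malg_mul 0 f = 0.
Proof. by apply: (@addIr _ (malg_mul 0 f)); rewrite -malg_mulDl !add0r. Qed.

Lemma malg_mul0r f : malg_mul f 0 = 0.
Proof. by apply: (@addIr _ (malg_mul f 0)); rewrite -malg_mulDr !add0r. Qed.

Lemma malg_mulA :
  (forall k x l y n z, malg_mul << x *g k >> (M l y n z) =
                       malg_mul (M k x l y) << z *g n >>) ->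
  associative malg_mul.
Proof.
move=> MA f g h; elim/malg_ind: f => [|f f' IH IH'|k x].
- by rewrite !malg_mul0l.
- by rewrite !malg_mulDl IH IH'.
elim/malg_ind: g => [|g g' IH IH'|l y].
- by rewrite !(malg_mul0l, malg_mul0r).
- by rewrite !(malg_mulDl, malg_mulDr) IH IH'.
elim/malg_ind: h => [|h h' IH IH'|n z].
- by rewrite !malg_mul0r.
- by rewrite !malg_mulDr IH IH'.
by rewrite !malg_mulUU MA.
Qed.

End MalgMul.

Section Grassmann.
Variable F : fieldType.

(* The finite subset {i1 < ... < ik} of nat stands for the monomial
   theta_i1 ... theta_ik; these monomials form an F-basis of the direct
   limit of the exterior algebras on theta_0, ..., theta_(k-1). *)
Definition grassmann : Type := {malg F[{fset nat}]}.

HB.instance Definition _ := GRing.Zmodule.on grassmann.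

Implicit Types (A B C : {fset nat}) (x y : grassmann).

Definition fset_inv A B : nat := (\sum_(i <- A) \sum_(j <- B) (j < i))%N.

Definition gmon_mul A (a : F) B (b : F) : {malg F[{fset nat}]} :=
  if [disjoint A & B]%fset
  then << (-1) ^+ fset_inv A B * (a * b) *g (A `|` B)%fset >> else 0.

Definition gmul (x y : grassmann) : grassmann := malg_mul gmon_mul x y.

Definition gone : grassmann := << 1 *g fset0 >>.

Lemma gmon_mulDl A B b : {morph (fun a => gmon_mul A a B b) : x y / x + y}.
Proof.
move=> a a'; rewrite /gmon_mul; case: [disjoint A & B]%fset; last by rewrite addr0.
by rewrite mulrDl mulrDr monalgUD.
Qed.

Lemma gmon_mulDr A a B : {morph gmon_mul A a B : x y / x + y}.
Proof.
move=> b b'; rewrite /gmon_mul; case: [disjoint A & B]%fset; last by rewrite addr0.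
by rewrite !mulrDr monalgUD.
Qed.

Lemma sum_fsetU A B (f : nat -> nat) : [disjoint A & B]%fset ->
  (\sum_(i <- (A `|` B)%fset) f i = \sum_(i <- A) f i + \sum_(i <- B) f i)%N.
Proof.
move=> /fdisjointP dAB; rewrite -big_cat; apply: perm_big; apply: uniq_perm => //.
  rewrite cat_uniq !fset_uniq andbT /=.
  by apply/hasPn => i iB; apply/negP => /dAB; rewrite iB.
by move=> i; rewrite mem_cat in_fsetU.
Qed.

Lemma fset_invUl A B C : [disjoint A & B]%fset ->
  fset_inv (A `|` B)%fset C = (fset_inv A C + fset_inv B C)%N.
Proof. by move=> dAB; rewrite /fset_inv sum_fsetU. Qed.

Lemma fset_invUr A B C : [disjoint A & B]%fset ->
  fset_inv C (A `|` B)%fset = (fset_inv C A + fset_inv C B)%N.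
Proof.
move=> dAB; rewrite /fset_inv -big_split /=; apply: eq_bigr => i _.
by rewrite sum_fsetU.
Qed.

Lemma fdisjointUr A B C : [disjoint A & (B `|` C)]%fset =
  [disjoint A & B]%fset && [disjoint A & C]%fset.
Proof.
apply/fdisjointP/andP => [H|[/fdisjointP H1 /fdisjointP H2] i iA].
  by split; apply/fdisjointP => i /H; rewrite in_fsetU negb_or => /andP[].
by rewrite in_fsetU negb_or H1 // H2.
Qed.

Lemma gmulA : associative gmul.
Proof.
apply: (malg_mulA gmon_mulDl gmon_mulDr) => A a B b C c.
have mU := malg_mulUU gmon_mulDl gmon_mulDr.
have m0l := malg_mul0l gmon_mulDl.
have m0r := malg_mul0r gmon_mulDr.
rewrite [gmon_mul A a B b]/gmon_mul [gmon_mul B b C c]/gmon_mul.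
case: (boolP [disjoint B & C]%fset) => dBC; last first.
  rewrite m0r; case: [disjoint A & B]%fset; last by rewrite m0l.
  rewrite mU /gmon_mul fdisjoint_sym fdisjointUr.
  by rewrite [[disjoint C & B]%fset]fdisjoint_sym (negbTE dBC) andbF.
rewrite mU {1}/gmon_mul fdisjointUr.
case: (boolP [disjoint A & B]%fset) => dAB /=; last by rewrite m0l.
rewrite mU /gmon_mul [[disjoint (A `|` B) & C]%fset]fdisjoint_sym fdisjointUr.
rewrite [[disjoint C & B]%fset]fdisjoint_sym dBC andbT.
rewrite [[disjoint C & A]%fset]fdisjoint_sym; case: [disjoint A & C]%fset => //.
rewrite fsetUA (fset_invUl _ dAB) (fset_invUr _ dBC); congr << _ *g _ >>.
rewrite !exprD -!mulrA !(mulrCA _ ((-1) ^+ fset_inv A B)).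
by congr (_ * (_ * _)); rewrite mulrCA.
Qed.

Lemma gmul1l : left_id gone gmul.
Proof.
move=> f; elim/malg_ind: f => [|f g IH IH'|A a].
- exact: (malg_mul0r gmon_mulDr).
- by rewrite /gmul (malg_mulDr gmon_mulDr) -!/(gmul _ _) IH IH'.
rewrite /gmul (malg_mulUU gmon_mulDl gmon_mulDr) /gmon_mul fdisjoint0X fset0U.
by rewrite /fset_inv big_seq_fset0 !mul1r.
Qed.

Lemma gmul1r : right_id gone gmul.
Proof.
move=> f; elim/malg_ind: f => [|f g IH IH'|A a].
- exact: (malg_mul0l gmon_mulDl).
- by rewrite /gmul (malg_mulDl gmon_mulDl) -!/(gmul _ _) IH IH'.
rewrite /gmul (malg_mulUU gmon_mulDl gmon_mulDr) /gmon_mul fdisjointX0 fsetU0.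
rewrite /fset_inv big1 ?mul1r ?mulr1 // => i _; exact: big_seq_fset0.
Qed.

Lemma gone_neq0 : gone != 0.
Proof. by rewrite /gone monalgU_eq0 oner_neq0. Qed.

HB.instance Definition _ := GRing.Zmodule_isNzRing.Build grassmann
  gmulA gmul1l gmul1r (malg_mulDl gmon_mulDl) (malg_mulDr gmon_mulDr) gone_neq0.

Definition ghomog (p : bool) (x : grassmann) : bool :=
  all (fun A => odd #|` A| == p) (msupp x).

(* ginv p is the p-th power of the grading involution x |-> (-1)^|x| x *)
Definition ginv (p : bool) (x : grassmann) : grassmann :=
  [malg A in msupp x => (-1) ^+ (p && odd #|` A|) * x@_A].

Lemma mcoeff_ginv p x A : (ginv p x)@_A = (-1) ^+ (p && odd #|` A|) * x@_A.
Proof. by rewrite mcoeffE; case: msuppP => //; rewrite mulr0. Qed.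

Lemma ginvD p : {morph ginv p : x y / x + y}.
Proof.
by move=> x y; apply/malgP => A; rewrite !(mcoeff_ginv, mcoeffD) mulrDr.
Qed.

Lemma ginv0 p : ginv p 0 = 0.
Proof. by apply/malgP => A; rewrite mcoeff_ginv !mcoeff0 mulr0. Qed.

Lemma ginvU p A a : ginv p << a *g A >> = << (-1) ^+ (p && odd #|` A|) * a *g A >>.
Proof.
apply/malgP => B; rewrite mcoeff_ginv !mcoeffU.
by case: eqP => [->|_]; rewrite ?mulr0.
Qed.

Lemma ginv1 p : ginv p 1 = 1.
Proof. by rewrite [LHS]ginvU cardfs0 andbF mul1r. Qed.

Lemma ginvK p q x : ginv p (ginv q x) = ginv (p (+) q) x.
Proof.
apply/malgP => A; rewrite !mcoeff_ginv mulrA -signr_addb.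
by case: p q (odd _) => [] [] [].
Qed.

Lemma ginv00 x : ginv false x = x.
Proof. by apply/malgP => A; rewrite mcoeff_ginv mul1r. Qed.

Lemma ginvM p : {morph ginv p : x y / x * y}.
Proof.
move=> x y; elim/malg_ind: x => [|x x' IH IH'|A a].
- by rewrite !(mul0r, ginv0).
- rewrite (mulrDl (x : grassmann) x' y).
  by rewrite !ginvD IH IH' mulrDl.
elim/malg_ind: y => [|y y' IH IH'|B b].
- by rewrite !(mulr0, ginv0).
- rewrite (mulrDr _ (y : grassmann) y').
  by rewrite !ginvD IH IH' mulrDr.
rewrite !ginvU [in LHS]/GRing.mul [in RHS]/GRing.mul /= /gmul.
rewrite !(malg_mulUU gmon_mulDl gmon_mulDr) /gmon_mul.
case: (boolP [disjoint A & B]%fset) => dAB; last by rewrite ginv0.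
rewrite ginvU; congr << _ *g _ >>.
have -> : odd #|` (A `|` B)%fset| = odd #|` A| (+) odd #|` B|.
  by rewrite cardfsU; move: dAB; rewrite -fsetI_eq0 => /eqP ->; rewrite cardfs0 subn0 oddD.
rewrite andb_addr signr_addb mulrCA; congr (_ * _).
by rewrite mulrACA.
Qed.
End Grassmann.

(* The tensor algebra over grassmann F of the free supermodule with basis B,
   where par b is the parity of the basis vector b.  Elements are the finite
   left combinations of words in B.  A scalar moves past a word w with the
   Koszul sign, w * y = ginv |w| y * w, which is the bimodule structure given by
   supercommutativity; hence the concatenation product below. *)
Definition tensalg (F : fieldType) (B : finType) (par : B -> bool) : Type :=
  {malg (grassmann F)[seq B]}.

Section TensorAlgebra.
Variables (F : fieldType) (B : finType) (par : B -> bool).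
Local Notation L := (grassmann F).
Local Notation T := (tensalg F par).

HB.instance Definition _ := GRing.Zmodule.on T.

Definition wpar (w : seq B) : bool := odd (count par w).

Definition tmon_mul (v : seq B) (x : L) (w : seq B) (y : L) : {malg L[seq B]} :=
  << x * ginv (wpar v) y *g v ++ w >>.

Definition tmul (f g : T) : T := malg_mul tmon_mul f g.

Definition tone : T := << 1 *g [::] >>.

Lemma wpar_cat v w : wpar (v ++ w) = wpar v (+) wpar w.
Proof. by rewrite /wpar count_cat oddD. Qed.

Lemma tmon_mulDl v w y : {morph (fun x => tmon_mul v x w y) : x z / x + z}.
Proof. by move=> x z; rewrite /tmon_mul mulrDl monalgUD. Qed.

Lemma tmon_mulDr v x w : {morph tmon_mul v x w : y z / y + z}.
Proof. by move=> y z; rewrite /tmon_mul ginvD mulrDr monalgUD. Qed.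

Lemma tmulA : associative tmul.
Proof.
apply: (malg_mulA tmon_mulDl tmon_mulDr) => u x v y w z.
rewrite !(malg_mulUU tmon_mulDl tmon_mulDr) /tmon_mul.
by rewrite ginvM ginvK wpar_cat catA mulrA.
Qed.

Lemma tmul1l : left_id tone tmul.
Proof.
move=> f; elim/malg_ind: f => [|f g IH IH'|w x].
- exact: (malg_mul0r tmon_mulDr).
- by rewrite /tmul (malg_mulDr tmon_mulDr) -!/(tmul _ _) IH IH'.
by rewrite /tmul (malg_mulUU tmon_mulDl tmon_mulDr) /tmon_mul ginv00 mul1r.
Qed.

Lemma tmul1r : right_id tone tmul.
Proof.
move=> f; elim/malg_ind: f => [|f g IH IH'|w x].
- exact: (malg_mul0l tmon_mulDl).
- by rewrite /tmul (malg_mulDl tmon_mulDl) -!/(tmul _ _) IH IH'.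
by rewrite /tmul (malg_mulUU tmon_mulDl tmon_mulDr) /tmon_mul ginv1 mulr1 cats0.
Qed.

Lemma tone_neq0 : tone != 0.
Proof. by rewrite /tone monalgU_eq0 oner_neq0. Qed.

HB.instance Definition _ := GRing.Zmodule_isNzRing.Build T
  tmulA tmul1l tmul1r (malg_mulDl tmon_mulDl) (malg_mulDr tmon_mulDr) tone_neq0.

(* The free supermodule itself, by left coordinates. *)
Definition tvec (v : {ffun B -> L}) : T := \sum_b << v b *g [:: b] >>.

Definition vhomog (p : bool) (v : {ffun B -> L}) : bool :=
  [forall b, ghomog (p (+) par b) (v b)].

Definition in_tdeg (r : nat) (x : T) : bool :=
  all (fun w => size w == r) (msupp x).

Inductive super_ideal : T -> Prop :=
| super_ideal0 : super_ideal 0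
| super_idealD x y : super_ideal x -> super_ideal y -> super_ideal (x + y)
| super_ideal_gen a c p q u v : vhomog p u -> vhomog q v ->
    super_ideal
      (a * (tvec u * tvec v - (-1) ^+ (p && q) * (tvec v * tvec u)) * c).

Definition super_idealb : {pred T} := fun x => `[< super_ideal x >].

Lemma super_idealMl a x : super_ideal x -> super_ideal (a * x).
Proof.
elim=> [|y z _ IH _ IH'|b c p q u v hu hv].
- by rewrite mulr0; constructor.
- by rewrite mulrDr; constructor.
by rewrite mulrA (mulrA a b); constructor.
Qed.

Lemma super_idealMr a x : super_ideal x -> super_ideal (x * a).
Proof.
elim=> [|y z _ IH _ IH'|b c p q u v hu hv].
- by rewrite mul0r; constructor.
- by rewrite mulrDl; constructor.
by rewrite -(mulrA _ c a); constructor.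
Qed.

Lemma super_ideal_zmod : zmod_closed super_idealb.
Proof.
split; first by apply/asboolP; constructor.
move=> x y /asboolP hx /asboolP hy; apply/asboolP; constructor=> //.
by rewrite -mulN1r; apply: super_idealMl.
Qed.

HB.instance Definition _ := GRing.isZmodClosed.Build T super_idealb super_ideal_zmod.

End TensorAlgebra.

Definition symalg (F : fieldType) (B : finType) (par : B -> bool) : Type :=
  Quotient.quot (@super_idealb F B par).

Section SymAlgebra.
Variables (F : fieldType) (B : finType) (par : B -> bool).
Local Notation T := (tensalg F par).
Local Notation S := (symalg F par).
Local Notation Q := (Quotient.quot (@super_idealb F B par)).

HB.instance Definition _ := GRing.Zmodule.on S.

Definition to_sym (x : T) : S := \pi_Q%qT x.

Lemma to_sym_surj (f : S) : exists x, to_sym x = f.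
Proof. by exists (repr f); rewrite /to_sym reprK. Qed.

Lemma to_sym_eq x y : to_sym x = to_sym y <-> super_ideal (x - y).
Proof.
split=> [/eqP|h]; rewrite /to_sym.
  by rewrite -Quotient.idealrBE => /asboolP.
by apply/eqP; rewrite -Quotient.idealrBE; apply/asboolP.
Qed.

Lemma to_symB : {morph to_sym : x y / x - y}.
Proof. by move=> x y; apply: raddfB. Qed.

Lemma to_symD : {morph to_sym : x y / x + y}.
Proof. by move=> x y; apply: raddfD. Qed.

Definition sone : S := to_sym 1.
Definition smul (f g : S) : S := to_sym (repr f * repr g).

Lemma to_symM x y : to_sym (x * y) = smul (to_sym x) (to_sym y).
Proof.
have rK z : super_ideal (z - repr (to_sym z)).
  by apply/to_sym_eq; rewrite /to_sym reprK.
apply/to_sym_eq; set x' : T := repr (to_sym x); set y' : T := repr (to_sym y).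
have -> : x * y - x' * y' = (x - x') * y + x' * (y - y').
  by rewrite mulrBl mulrBr addrA subrK.
apply: super_idealD; first exact: super_idealMr (rK x).
exact: super_idealMl (rK y).
Qed.

Lemma symP (P : S -> Prop) : (forall x, P (to_sym x)) -> forall f, P f.
Proof. by move=> H f; have [x <-] := to_sym_surj f. Qed.

Lemma smulA : associative smul.
Proof.
elim/symP => x; elim/symP => y; elim/symP => z.
by rewrite -!to_symM mulrA.
Qed.

Lemma smul1l : left_id sone smul.
Proof. by elim/symP => x; rewrite -to_symM mul1r. Qed.

Lemma smul1r : right_id sone smul.
Proof. by elim/symP => x; rewrite -to_symM mulr1. Qed.

Lemma smulDl : left_distributive smul +%R.
Proof.
elim/symP => x; elim/symP => y; elim/symP => z.
by rewrite -to_symD -!to_symM mulrDl to_symD.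
Qed.

Lemma smulDr : right_distributive smul +%R.
Proof.
elim/symP => x; elim/symP => y; elim/symP => z.
by rewrite -to_symD -!to_symM mulrDr to_symD.
Qed.

HB.instance Definition _ := GRing.Zmodule_isPzRing.Build S
  smulA smul1l smul1r smulDl smulDr.

HB.instance Definition _ := GRing.isZmodMorphism.Build T S to_sym to_symB.
HB.instance Definition _ := GRing.isMonoidMorphism.Build T S to_sym
  (erefl, to_symM).

End SymAlgebra.

Section Restitution.
Variables (F : fieldType) (B : finType) (par : B -> bool).
Local Notation L := (grassmann F).
Local Notation T := (tensalg F par).
Local Notation S := (symalg F par).

(* B indexes both the basis of W and the dual basis of the dual module of W
   (a dual vector has the parity of the vector), so T is used for both tensor
   algebras.  For basis words f and w of the same length, the product of the
   f_j(w_j) is 1 if the two words agree and 0 otherwise, and the sign is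
   (-1) ^ (sum_j |w_j| (|f_(j+1)| + |f_(j+2)| + ...)). *)
Definition ev_word (f w : seq B) : L :=
  (-1) ^+ (\sum_(j < size w) \sum_(k < size f | j < k)
             nth false (map par w) j * nth false (map par f) k)%N
  * (f == w)%:R.

(* The left-linear extension of ev_word.  In the tensor product over
   grassmann F of the two tensor algebras, the tensor product of x f and y w is
   x * ginv |f| y times the tensor product of f and w. *)
Definition ev (g h : T) : L :=
  \sum_(f <- msupp g) \sum_(w <- msupp h)
    g@_f * ginv (wpar par f) h@_w * ev_word f w.

Definition even_part : Type := {w : {ffun B -> L} | vhomog par false w}.

(* The value does not depend on the lift chosen by xget; the default 0 is only
   used if f is not of degree r. *)
Definition restitution (r : nat) (f : S) (w : even_part) : L :=
  ev (xget 0 [set g : T | in_tdeg r g /\ to_sym g = f]%classic)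
     (tvec par (val w) ^+ r).

End Restitution.

Section PermutingFactors.
Variables (F : fieldType) (B : finType) (par : B -> bool).
Local Notation T := (tensalg F par).

(* A rearrangement of the factors of a word of length l is given by the list p
   of positions in 0, ..., l - 1, in which p_k is the original position of the
   factor that becomes the k-th one.  The Koszul sign counts the pairs of odd
   factors whose order is reversed. *)
Definition koszul (p : seq nat) (w : seq B) : nat :=
  (\sum_(k < size p) \sum_(l < size p | (k < l) && (nth 0 p l < nth 0 p k))
     nth false (map par w) (nth 0 p k) * nth false (map par w) (nth 0 p l))%N.

Definition rearrange (p : seq B -> seq nat) (x : T) : T :=
  \sum_(w <- msupp x)
    << x@_w * (-1) ^+ koszul (p w) w *g pmap (onth w) (p w) >>.

End PermutingFactors.

(* The tensor products of copies of U (with basis E) and of its dual are taken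
   inside the tensor algebra of the direct sum of U and its dual: the letter
   inl e is the basis vector e of U and inr e the dual basis vector of e. *)
Section MixedTensors.
Variables (F : fieldType) (E : finType) (par : E -> bool).
Local Notation L := (grassmann F).

Definition mixed_par (c : E + E) : bool :=
  match c with inl e => par e | inr e => par e end.

Local Notation T := (tensalg F mixed_par).

(* basis of the tensor product of b copies of U and t copies of its dual *)
Definition mbasis (b t : nat) : Type := (b.-tuple E * t.-tuple E)%type.

HB.instance Definition _ b t := Finite.on (mbasis b t).

Definition mbasis_par b t (c : mbasis b t) : bool :=
  wpar par c.1 (+) wpar par c.2.

Definition mtens b t (u : {ffun mbasis b t -> L}) : T :=
  \sum_(c : mbasis b t) << u c *g map inl (val c.1) ++ map inr (val c.2) >>.

Variables (N : nat) (sigma : 'S_N).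

(* All the U-factors in their original order, then all the dual factors. *)
Definition mu_pos (w : seq (E + E)) : seq nat :=
  let isU k := if onth w k is Some (inl _) then true else false in
  [seq k <- iota 0 (size w) | isU k] ++ [seq k <- iota 0 (size w) | ~~ isU k].

(* On N factors U followed by N dual factors. *)
Definition sigma_pos (w : seq (E + E)) : seq nat :=
  [seq val ((sigma^-1)%g k) | k <- enum 'I_N] ++ iota N N.

Definition tau_pos (w : seq (E + E)) : seq nat :=
  flatten [seq [:: k; (N + k)%N] | k <- iota 0 N].

Definition nu_pos (w : seq (E + E)) : seq nat :=
  flatten [seq [:: k.*2.+1; k.*2] | k <- iota 0 N].

Fixpoint contract_word (w : seq (E + E)) : L :=
  match w with
  | [::] => 1
  | inr f :: inl v :: w' => (f == v)%:R * contract_word w'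
  | _ => 0
  end.

Definition contract (x : T) : L := \sum_(w <- msupp x) x@_w * contract_word w.

(* Meant to be applied to tensors with N factors U and N dual factors. *)
Definition T_sigma (x : T) : L :=
  contract (rearrange nu_pos (rearrange tau_pos
    (rearrange sigma_pos (rearrange mu_pos x)))).

End MixedTensors.

Section Setting.
Variables (m n s : nat) (b t : 'I_s -> nat).

Definition Upar (e : 'I_(m + n)) : bool := (m <= e)%N.

(* Basis of W: Tagged _ (l, u), with tag i, is the tensor product of the e_(l_k)
   and of the dual vectors of the e_(u_k), in the i-th summand. *)
Definition Wbasis : finType := {i : 'I_s & mbasis 'I_(m + n) (b i) (t i)}.

Definition Wpar (c : Wbasis) : bool := mbasis_par Upar (tagged c).

Variable F : fieldType.
Local Notation L := (grassmann F).
Local Notation S := (symalg F Wpar).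

Definition W0 : Type := even_part F Wpar.

Definition component (w : W0) (i : 'I_s) :
    {ffun mbasis 'I_(m + n) (b i) (t i) -> L} :=
  [ffun c => val w (Tagged (fun i => mbasis 'I_(m + n) (b i) (t i)) c)].

Definition Tdual (i : 'I_s) (l : (b i).-tuple 'I_(m + n))
    (u : (t i).-tuple 'I_(m + n)) : S :=
  to_sym
    << 1 *g [:: Tagged (fun i => mbasis 'I_(m + n) (b i) (t i)) (l, u)] >>.

Variable mult : 'I_s -> nat.

Definition in_multidegree (f : S) : Prop :=
  exists2 g : tensalg F Wpar,
    (forall w, w \in msupp g ->
       forall i, count (fun c => tag c == i) w = mult i)
    & to_sym g = f.

(* Number of factors U (for c := b), or of dual factors (for c := t), to the
   left of the j-th copy of the i-th summand; i and j are numbered from 0. *)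
Definition offset (c : 'I_s -> nat) (i : 'I_s) (j : nat) : nat :=
  (\sum_(p < s | p < i) mult p * c p + j * c i)%N.

Lemma offset_lt (c : 'I_s -> nat) N (hN : (\sum_k mult k * c k)%N = N)
    (i : 'I_s) (j : 'I_(mult i)) (l : 'I_(c i)) : (offset c i j + l < N)%N.
Proof.
rewrite -hN /offset [X in (_ < X)%N](bigID (fun p : 'I_s => (p < i)%N)) /= -addnA ltn_add2l.
rewrite (bigD1 i) ?ltnn //=; apply: leq_trans (leq_addr _ _).
apply: (@leq_trans (j * c i + c i)%N); first by rewrite ltn_add2l.
by rewrite addnC -mulSn leq_mul2r ltn_ord orbT.
Qed.

Definition position (c : 'I_s -> nat) N (hN : (\sum_k mult k * c k)%N = N)
    (i : 'I_s) (j : 'I_(mult i)) (l : 'I_(c i)) : 'I_N :=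
  Ordinal (offset_lt hN j l).

Variables (N : nat).
Hypotheses (hb : (\sum_k mult k * b k)%N = N) (ht : (\sum_k mult k * t k)%N = N).
Variable sigma : 'S_N.

Local Notation slot := {i : 'I_s & 'I_(mult i)}.

Definition slot_lt (x y : slot) : bool :=
  (tag x < tag y)%N || (tag x == tag y) && (tagged x < tagged y)%N.

Section Term.
Variable r : {ffun 'I_N -> 'I_(m + n)}.

Let a (k : 'I_N) : nat := Upar (r k).

Definition gamma_sign : S :=
  \prod_(k < N) \prod_(l < N | (k < l)%N && (sigma l < sigma k)%N)
    (-1) ^+ (a (sigma k) * a (sigma l))%N.

Definition lower_deg (x : slot) : nat :=
  (\sum_(l < b (tag x)) a (sigma (position hb (tagged x) l)))%N.

Definition factor_deg (x : slot) : nat :=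
  (lower_deg x + \sum_(k < t (tag x)) a (position ht (tagged x) k))%N.

Definition q_exponent : nat :=
  (\sum_(x : slot) lower_deg x * (\sum_(k < N | k < offset t (tag x) (tagged x)) a k)
  + \sum_(k < N) a k
  + \sum_(k < N) \sum_(l < N | k < l) a k * a l
  + \sum_(x : slot) \sum_(y : slot | slot_lt x y) factor_deg x * factor_deg y)%N.

Definition picture_term : S :=
  gamma_sign * (-1) ^+ q_exponent *
  \prod_(i < s) \prod_(j < mult i)
    Tdual [tuple r (sigma (position hb j l)) | l < b i]
          [tuple r (position ht j k) | k < t i].

End Term.

Definition picture : S := \sum_(r : {ffun 'I_N -> 'I_(m + n)}) picture_term r.

End Setting.

(* Main.v *)
(* Evaluation at an even vector w of W sends the word f_1 ... f_r of dual basis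
   vectors to the product of the numbers f_j(w), in order, up to the sign
   (-1)^(|f_1| + ... + |f_r|): the Koszul sign in the definition of ev cancels
   the one that arises in expanding w (x) ... (x) w.  This is a ring morphism
   from the tensor algebra to the Grassmann algebra that kills the
   supercommutators, so the restitution of the picture invariant is a sum over
   r_1, ..., r_N of signed monomials in the coordinates of w.

   On the other side, T_sigma is expanded in the basis of the product of tensors.
   The contraction in its last step leaves exactly the basis words obtained from
   some r_1, ..., r_N, and each of its steps contributes one of the terms of
   gamma and q: mu gives the sum of lower degrees times earlier parities, sigma
   gives gamma, tau and nu give the sums over a_k a_l and a_k, and the expansion
   itself gives the sum over d_{i,j} d_{i',j'}. *)

Require Import Defs.
From mathcomp Require Import all_boot perm ssralg complex reals zify.
From mathcomp Require Import finmap monalg boolp classical_sets.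

Set Implicit Arguments.
Unset Strict Implicit.
Unset Printing Implicit Defensive.

Import GRing.Theory.
Local Open Scope ring_scope.

(** * Sums over ordered pairs of entries of a list *)

Section PairSum.
Local Open Scope nat_scope.

(** Common form of all the sign exponents below. Recursion on a list makes it split along [++] and
    [flatten], which double sums over ordinals do not do directly. *)
Fixpoint pair_sum (T : Type) (R : T -> T -> nat) (s : seq T) : nat :=
  if s is x :: s' then \sum_(y <- s') R x y + pair_sum R s' else 0.

Lemma pair_sum_cat T (R : T -> T -> nat) s1 s2 :
  pair_sum R (s1 ++ s2) =
  pair_sum R s1 + pair_sum R s2 + \sum_(x <- s1) \sum_(y <- s2) R x y.
Proof.
elim: s1 => [|x s1 IH] /=; first by rewrite big_nil addn0.
by rewrite big_cons big_cat /= IH; lia.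
Qed.

Lemma pair_sum_map T T' (f : T' -> T) (R : T -> T -> nat) s :
  pair_sum R [seq f x | x <- s] = pair_sum (fun x y => R (f x) (f y)) s.
Proof. by elim: s => //= x s ->; rewrite big_map. Qed.

Lemma pair_sum_flatten T (R : T -> T -> nat) ss :
  pair_sum R (flatten ss) =
  pair_sum (fun s1 s2 => \sum_(x <- s1) \sum_(y <- s2) R x y) ss
  + \sum_(s <- ss) pair_sum R s.
Proof.
elim: ss => [|s ss IH] /=; first by rewrite big_nil.
have -> : \sum_(s' <- ss) \sum_(x <- s) \sum_(y <- s') R x y
          = \sum_(x <- s) \sum_(y <- flatten ss) R x y.
  by rewrite exchange_big; apply: eq_bigr => x _; rewrite big_flatten.
by rewrite pair_sum_cat IH big_cons; lia.
Qed.

Lemma eq_pair_sum (T : Type) (r : rel T) (R R' : T -> T -> nat) s :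
  pairwise r s -> (forall x y, r x y -> R x y = R' x y) ->
  pair_sum R s = pair_sum R' s.
Proof.
move=> + RR'; elim: s => //= x s IH /andP[xs /IH ->]; congr (_ + _).
elim: s xs {IH} => [|y s IH] /=; first by rewrite !big_nil.
by case/andP => xy /IH; rewrite !big_cons (RR' _ _ xy) => ->.
Qed.

Lemma pair_sum_eq0 (T : Type) (r : rel T) (R : T -> T -> nat) s :
  pairwise r s -> (forall x y, r x y -> R x y = 0) -> pair_sum R s = 0.
Proof.
move=> rs /(eq_pair_sum (R' := fun _ _ => 0) rs) ->.
by elim: s {rs} => //= x s ->; rewrite big1.
Qed.

(** Asymmetry makes [r] pick each pair in its list order only, and it excludes the diagonal as a
    special case. *)
Lemma pair_sumE (T : eqType) (r : rel T) (R : T -> T -> nat) s :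
  pairwise r s -> (forall x y, r x y -> ~~ r y x) ->
  pair_sum R s = \sum_(x <- s) \sum_(y <- s | r x y) R x y.
Proof.
move=> + asym; have irr x : r x x = false.
  by apply/negP => rx; move: (asym _ _ rx); rewrite rx.
elim: s => [|x s IH] /=; first by rewrite big_nil.
case/andP => /allP xs /IH ->; rewrite !big_cons irr; congr (_ + _).
  rewrite [RHS]big_mkcond; apply: eq_big_seq => y ys.
  by rewrite xs.
apply: eq_big_seq => y ys; rewrite big_cons.
by rewrite (negbTE (asym _ _ (xs _ ys))).
Qed.

Lemma pairwise_ltn_iota a k : pairwise ltn (iota a k).
Proof. by rewrite -(sorted_pairwise ltn_trans) iota_ltn_sorted. Qed.

Lemma pairwise_enum_ord n : pairwise (fun i j : 'I_n => i < j) (enum 'I_n).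
Proof. by rewrite -(pairwise_map val ltn) val_enum_ord pairwise_ltn_iota. Qed.

Lemma pair_sum_ord n (R : 'I_n -> 'I_n -> nat) :
  pair_sum R (enum 'I_n) = \sum_(i < n) \sum_(j < n | i < j) R i j.
Proof.
rewrite (pair_sumE _ (@pairwise_enum_ord n)) => [|i j].
  by rewrite big_enum; apply: eq_bigr => i _; rewrite big_enum_cond.
by rewrite -leqNgt => /ltnW.
Qed.

Lemma pair_sum_nth (T : Type) (x0 : T) (R : T -> T -> nat) s :
  pair_sum R s =
  \sum_(i < size s) \sum_(j < size s | i < j) R (nth x0 s i) (nth x0 s j).
Proof.
rewrite -(pair_sum_ord (fun i j : 'I_(size s) => R (nth x0 s i) (nth x0 s j))).
rewrite -(pair_sum_map (fun i : 'I_(size s) => nth x0 s i)).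
by rewrite (map_comp (nth x0 s)) val_enum_ord map_nth_iota0 // take_size.
Qed.

End PairSum.

(** Puts the Koszul sign in a form in which the list of positions can be cut into blocks. *)
Lemma koszulE (B : finType) (par : B -> bool) p w :
  koszul par p w =
  pair_sum (fun i j => if (j < i)%N
    then (nth false (map par w) i * nth false (map par w) j)%N else 0%N) p.
Proof.
rewrite (pair_sum_nth 0); apply: eq_bigr => i _.
by rewrite big_mkcondr.
Qed.

(** * Supercommutativity of the Grassmann algebra *)

Section Homogeneous.
Variable F : fieldType.
Implicit Types (x y : grassmann F) (A B : {fset nat}).

Lemma ginv_sign p (e : nat) : ginv p ((-1) ^+ e : grassmann F) = (-1) ^+ e.
Proof.
elim: e => [|e IH]; first exact: ginv1.
rewrite exprS ginvM IH; congr (_ * _).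
have := ginvD p (-1 : grassmann F) 1.
by rewrite addNr ginv0 ginv1 => /esym /eqP; rewrite addr_eq0 => /eqP.
Qed.

Lemma ginv_ghomog q p x : ghomog p x -> ginv q x = (-1) ^+ (q && p) * x.
Proof.
move=> /allP hx; apply/malgP => A; rewrite mcoeff_ginv.
have -> : ((-1) ^+ (q && p) * x)@_A = (-1) ^+ (q && p) * x@_A.
  by case: (q && p); rewrite ?mulN1r ?mul1r //; apply: mcoeffN.
case: (boolP (A \in msupp x)) => [/hx /eqP -> //|/mcoeff_outdom ->].
by rewrite !mulr0.
Qed.

(** As [A] and [B] are disjoint, each pair in their product is an inversion in exactly one of the
    two orders. *)
Lemma fset_inv_sym A B : [disjoint A & B]%fset ->
  (fset_inv A B + fset_inv B A)%N = (#|` A| * #|` B|)%N.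
Proof.
move=> /fdisjointP dAB; rewrite /fset_inv [X in (_ + X)%N]exchange_big -big_split /=.
rewrite -[#|` A|]sum1_size big_distrl; apply: eq_big_seq => i iA.
rewrite -big_split /= mul1n -[#|` B|]sum1_size; apply: eq_big_seq => j jB.
have : i != j by apply: contraNneq (dAB _ iA) => ->.
by case: ltngtP.
Qed.

Lemma gmon_mulC A a B b :
  @gmon_mul F A a B b = gmon_mul B ((-1) ^+ (odd #|` A| && odd #|` B|) * b) A a.
Proof.
rewrite /gmon_mul fdisjoint_sym; case: ifP => // dBA.
rewrite fsetUC; congr << _ *g _ >>.
rewrite -oddM signr_odd -fset_inv_sym 1?fdisjoint_sym // exprD -!mulrA.
by rewrite [RHS]mulrCA signrMK [b * a]mulrC.
Qed.

(** Supercommutativity with [y] not assumed homogeneous: [ginv p] puts the right sign on each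
    monomial of [y] separately. *)
Lemma ghomogC p x y : ghomog p x -> x * y = ginv p y * x.
Proof.
move=> /allP hx; elim/malg_ind: y => [|y z IH IH'|B b].
- by rewrite ginv0 mulr0 mul0r.
- rewrite (mulrDr x (y : grassmann F) z) IH IH' -mulrDl.
  by congr (_ * _); rewrite ginvD.
rewrite ginvU [LHS](_ : _ = \sum_(A <- msupp x) gmon_mul A x@_A B b); last first.
  by apply: eq_bigr => A _; apply: (mextU (gmon_mulDr A x@_A)).
rewrite [RHS](mextU (F := fun B b => mext (gmon_mul B b) x)) => [|C c c'].
  by apply: eq_big_seq => A /hx /eqP hA; rewrite gmon_mulC hA.
by rewrite /mext -big_split; apply: eq_bigr => A _; apply: gmon_mulDl.
Qed.

End Homogeneous.

(** * Evaluation at an even vector *)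

Lemma mulr_signCA (R : pzRingType) (e : nat) (x y : R) :
  x * ((-1) ^+ e * y) = (-1) ^+ e * (x * y).
Proof. by rewrite !mulrA commr_sign. Qed.

Lemma mulr_signAC (R : pzRingType) (d e : nat) (x y : R) :
  ((-1) ^+ d * x) * ((-1) ^+ e * y) = (-1) ^+ (d + e) * (x * y).
Proof. by rewrite mulr_signCA addnC exprD !mulrA. Qed.

Lemma mulr_signVK (R : pzRingType) (e : nat) (x y : R) :
  x * ((-1) ^+ e * y) * (-1) ^+ e = x * y.
Proof. by rewrite mulr_signCA commr_sign signrMK. Qed.

(** The computation behind [eval_evenM]: [x] moves past the coefficient [b] and changes it into
    [b']. *)
Lemma mulr_sign_exchange (R : pzRingType) (d e : nat) (a b b' x y : R) :
  x * b = b' * x ->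
  (a * b') * ((-1) ^+ d * (-1) ^+ e * (x * y)) =
  (a * ((-1) ^+ d * x)) * (b * ((-1) ^+ e * y)).
Proof.
move=> xb; rewrite [a * (_ * x)]mulr_signCA [b * (_ * y)]mulr_signCA mulr_signAC.
by rewrite -exprD mulr_signCA -!mulrA [x * (b * y)]mulrA xb -mulrA.
Qed.

Lemma mulr_sign_comm (R : pzRingType) (e : nat) (u x y y' y'' : R) :
  x * y = y' * x -> u * y' = y'' * u ->
  (u * ((-1) ^+ e * x)) * y = y'' * (u * ((-1) ^+ e * x)).
Proof.
by move=> xy uy; rewrite !mulr_signCA -!mulrA xy [u * _]mulrA uy -mulrA.
Qed.

Lemma morph_commutator_eq0 (R S : pzRingType) (f : R -> S) (a c e x y : R) :
  {morph f : x y / x + y} -> {morph f : x / - x} -> {morph f : x y / x * y} ->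
  f x * f y = f e * (f y * f x) ->
  f (a * (x * y - e * (y * x)) * c) = 0.
Proof. by move=> fD fN fM xy; rewrite !(fM, fD, fN) xy subrr mulr0 mul0r. Qed.

(** * Reduction of identities in the tensor algebra to monomials *)

Section TensorMonomials.
Variables (F : fieldType) (B : finType) (par : B -> bool).
Local Notation L := (grassmann F).
Local Notation T := (tensalg F par).

Lemma tensalg_ind (P : T -> Prop) :
  P 0 -> (forall x y, P x -> P y -> P (x + y)) ->
  (forall f (a : L), P << a *g f >>) -> forall x, P x.
Proof. exact: malg_ind. Qed.

Lemma tensalg_ext (V : zmodType) (f g : T -> V) :
  {morph f : x y / x + y} -> {morph g : x y / x + y} ->
  (forall v (a : L), f << a *g v >> = g << a *g v >>) -> f =1 g.
Proof.
move=> fD gD fg; elim/tensalg_ind => [|x y IH IH'|v a //].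
  have f0 : f 0 = 0 by apply: (@addIr _ (f 0)); rewrite -fD !add0r.
  by rewrite f0; apply: (@addIr _ (g 0)); rewrite -gD !add0r.
by rewrite fD gD IH IH'.
Qed.

Lemma tensalg_bilin_ext (V : zmodType) (f g : T -> T -> V) :
  (forall y, {morph f^~ y : x x' / x + x'}) ->
  (forall x, {morph f x : y y' / y + y'}) ->
  (forall y, {morph g^~ y : x x' / x + x'}) ->
  (forall x, {morph g x : y y' / y + y'}) ->
  (forall v (a : L) w (b : L), f << a *g v >> << b *g w >> = g << a *g v >> << b *g w >>) ->
  f =2 g.
Proof.
move=> fl fr gl gr fg x y; move: x.
apply: (tensalg_ext (fl y) (gl y)) => v a /=.
by move: y; apply: tensalg_ext.
Qed.

Lemma tmonM (v w : seq B) (x y : L) :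
  (<< x *g v >> : T) * << y *g w >> = << x * ginv (wpar par v) y *g v ++ w >>.
Proof. exact: (malg_mulUU (@tmon_mulDl F B par) (@tmon_mulDr F B par)). Qed.

Lemma tmon_sign e (w : seq B) (x : L) :
  (-1) ^+ e * (<< x *g w >> : T) = << (-1) ^+ e * x *g w >>.
Proof.
rewrite -signr_odd -[in RHS]signr_odd.
by case: odd; rewrite ?mulN1r ?mul1r // -monalgUN.
Qed.

End TensorMonomials.

Section EvenPoint.
Variables (F : fieldType) (B : finType) (par : B -> bool).
Variables (w : {ffun B -> grassmann F}) (hw : vhomog par false w).
Local Notation L := (grassmann F).
Local Notation T := (tensalg F par).

Let ghomog_w c : ghomog (par c) (w c).
Proof. by move/forallP: hw => /(_ c); rewrite addFb. Qed.

(** Since [w] is even, the coordinate [w c] has the parity of [c], so the product over a word has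
    the parity of the word. *)
Lemma even_prod_comm f (y : L) :
  (\prod_(c <- f) w c) * y = ginv (wpar par f) y * \prod_(c <- f) w c.
Proof.
elim: f y => [|c f IH] y; first by rewrite !big_nil ginv00 mulr1 mul1r.
rewrite !big_cons -mulrA IH mulrA (ghomogC _ (ghomog_w c)) ginvK -mulrA.
by rewrite -[c :: f]cat1s wpar_cat /wpar /= addn0 oddb.
Qed.

Lemma ginv_even_prod p f :
  ginv p (\prod_(c <- f) w c) = (-1) ^+ (p && wpar par f) * \prod_(c <- f) w c.
Proof.
elim: f => [|c f IH]; first by rewrite !big_nil ginv1 andbF mulr1.
rewrite !big_cons ginvM IH (ginv_ghomog _ (ghomog_w c)).
rewrite -[c :: f]cat1s wpar_cat {2}/wpar /= addn0 oddb.
rewrite mulr_signAC; congr (_ * _).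
by rewrite exprD -signr_addb andb_addr.
Qed.

(* The sign is that of f(y v) = (-1)^(|f||y|) y f(v), as the coordinate w c has
   the parity of c. *)
Definition eval_even (x : T) : L :=
  mext (fun f (a : L) => a * ((-1) ^+ wpar par f * \prod_(c <- f) w c)) x.

Lemma eval_evenD : {morph eval_even : x y / x + y}.
Proof. by apply: mextD => f x y; rewrite mulrDl. Qed.

Lemma eval_evenU f x :
  eval_even << x *g f >> = x * ((-1) ^+ wpar par f * \prod_(c <- f) w c).
Proof. by apply: mextU => f' a a'; rewrite mulrDl. Qed.

Lemma eval_even0 : eval_even 0 = 0.
Proof. by apply: (@addIr _ (eval_even 0)); rewrite -eval_evenD !add0r. Qed.

Lemma eval_evenN : {morph eval_even : x / - x}.
Proof.
by move=> x; apply: (@addIr _ (eval_even x)); rewrite -eval_evenD !addNr eval_even0.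
Qed.

Lemma eval_even1 : eval_even 1 = 1.
Proof. by rewrite eval_evenU big_nil !mulr1. Qed.

Lemma eval_even_sum (I : Type) (r : seq I) (P : pred I) (G : I -> T) :
  eval_even (\sum_(i <- r | P i) G i) = \sum_(i <- r | P i) eval_even (G i).
Proof. exact: (big_morph _ eval_evenD eval_even0). Qed.

Lemma eval_even_tvec u :
  eval_even (tvec par u) = \sum_c u c * ((-1) ^+ par c * w c).
Proof.
rewrite eval_even_sum; apply: eq_bigr => c _.
by rewrite eval_evenU big_seq1 /wpar /= addn0 oddb.
Qed.

(** The parity sign is multiplicative on words, and moving the product over [f] past [b] produces
    the same [ginv] as the multiplication of monomials. *)
Lemma eval_evenM : {morph eval_even : x y / x * y}.
Proof.
apply: tensalg_bilin_ext => [y x x'|x y y'|y x x'|x y y'|f a g b].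
- by rewrite mulrDl; apply: eval_evenD.
- by rewrite mulrDr; apply: eval_evenD.
- by rewrite eval_evenD mulrDl.
- by rewrite eval_evenD mulrDr.
rewrite tmonM !eval_evenU big_cat wpar_cat signr_addb /=.
exact: mulr_sign_exchange (even_prod_comm f b).
Qed.

(** The parity of [c] occurs in both [u c] and [w c] and cancels, so the value has parity [p]. *)
Lemma even_tvec_comm p (u : {ffun B -> L}) y : vhomog par p u ->
  eval_even (tvec par u) * y = ginv p y * eval_even (tvec par u).
Proof.
move=> /forallP hu; rewrite eval_even_tvec mulr_suml mulr_sumr.
apply: eq_bigr => c _; apply: mulr_sign_comm (ghomogC y (ghomog_w c)) _.
by rewrite (ghomogC _ (hu c)) ginvK -addbA addbb addbF.
Qed.

Lemma ginv_even_tvec p q (u : {ffun B -> L}) : vhomog par q u ->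
  ginv p (eval_even (tvec par u)) = (-1) ^+ (p && q) * eval_even (tvec par u).
Proof.
move=> /forallP hu; rewrite eval_even_tvec mulr_sumr.
rewrite (big_morph _ (@ginvD F p) (@ginv0 F p)).
apply: eq_bigr => c _; rewrite !ginvM ginv_sign.
rewrite (ginv_ghomog _ (hu c)) (ginv_ghomog _ (ghomog_w c)).
rewrite [(-1) ^+ par c * (_ * _)]mulr_signCA mulr_signAC; congr (_ * _).
by rewrite exprD -signr_addb; case: p q (par c) {hu} => [] [] [].
Qed.

(** Values of homogeneous vectors supercommute, so generators go to 0; multiplicativity takes care
    of the outer factors [a] and [c]. *)
Lemma eval_even_super_ideal x : super_ideal x -> eval_even x = 0.
Proof.
elim=> [|y z _ IH _ IH'|a c p q u v hu hv].
- exact: eval_even0.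
- by rewrite eval_evenD IH IH' addr0.
apply: (morph_commutator_eq0 _ _ eval_evenD eval_evenN eval_evenM).
apply: etrans (even_tvec_comm _ hu) _.
rewrite (ginv_even_tvec p hv) -mulrA; congr (_ * _).
apply: esym; case: (p && q); last exact: eval_even1.
by apply: etrans (eval_evenN 1) _; congr (- _); apply: eval_even1.
Qed.

(** Only the first letter can come from the vector; the coefficient of the remaining word moves past
    that letter, hence the [ginv]. *)
Lemma coef_tvecM (u : {ffun B -> L}) (y : T) f :
  (tvec par u * y)@_f =
  if f is c :: f' then u c * ginv (par c) y@_f' else 0.
Proof.
move: y; apply: tensalg_ext => [y y'|y y'|g b].
- by rewrite mulrDr; apply: mcoeffD.
- case: f => [|c f']; first by rewrite addr0.
  by rewrite -mulrDr -ginvD; congr (_ * ginv _ _); apply: mcoeffD.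
rewrite mulr_suml.
transitivity (\sum_c (u c * ginv (par c) b) *+ (c :: g == f)).
  rewrite raddf_sum; apply: eq_bigr => c _ /=.
  by rewrite tmonM mcoeffU /wpar /= addn0 oddb.
case: f => [|c f']; first by rewrite big1.
rewrite (bigD1 c) //= big1 => [|c' /negbTE c'c]; last by rewrite eqseq_cons c'c.
rewrite addr0 eqseq_cons eqxx mcoeffU /=.
by case: eqP; rewrite ?mulr1n ?mulr0n ?ginv0 ?mulr0.
Qed.

Lemma big_parM (c : B) f :
  (\sum_(d <- f) par c * par d = par c * count par f)%N.
Proof.
by rewrite -big_distrr -sum1_count [in RHS]big_mkcond; congr (_ * _)%N.
Qed.

(** Exponent of the sign that arises when the coordinates of an even tensor power are moved to the
    left of the basis word [f]. *)
Definition wsign f := pair_sum (fun c d => (par c * par d)%N) f.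

(** An odd [c] gives one sign for each odd letter of [f], which is the first summand of
    [wsign (c :: f)]. *)
Lemma even_prod_cons c f :
  w c * ginv (par c) ((-1) ^+ wsign f * \prod_(d <- f) w d) =
  (-1) ^+ wsign (c :: f) * \prod_(d <- c :: f) w d.
Proof.
rewrite big_cons ginvM ginv_sign ginv_even_prod [w c * (_ * (_ * _))]mulr_signCA.
rewrite [w c * (_ * _)]mulr_signCA mulrA -[(-1) ^+ (_ && _)]signr_odd; congr (_ * _).
rewrite exprD -signr_odd -[in RHS]signr_odd /wsign /=.
rewrite [RHS]commr_sign; congr (_ ^+ _ * _ ^+ _).
by rewrite big_parM oddM !oddb.
Qed.

Lemma coef_tvecX r f :
  (tvec par w ^+ r)@_f =
  if size f == r then (-1) ^+ wsign f * \prod_(c <- f) w c else 0.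
Proof.
elim: r f => [|r IH] f.
  rewrite expr0 mcoeffU; case: f => [|c f] //=.
  by rewrite big_nil mulr1.
rewrite exprS coef_tvecM; case: f => [|c f] //; rewrite IH /= eqSS.
by case: eqP => _; [apply: even_prod_cons | rewrite ginv0 mulr0].
Qed.

Lemma ev_wordff f : ev_word F par f f = (-1) ^+ wsign f.
Proof.
rewrite /ev_word eqxx mulr1 /wsign -(pair_sum_map par (fun a b : bool => (a * b)%N)).
by rewrite (pair_sum_nth false) size_map.
Qed.

(** Only equal words pair nontrivially. There the sign [wsign f] occurs both in the coefficient of
    the tensor power and in [ev_word], and cancels; [ginv] leaves the sign built into
    [eval_even]. *)
Lemma ev_tvecX r g : in_tdeg r g -> ev g (tvec par w ^+ r) = eval_even g.
Proof.
move=> /allP hg; apply: eq_big_seq => f /hg /= fr.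
set h := tvec par w ^+ r.
transitivity (g@_f * ginv (wpar par f) h@_f * ev_word F par f f).
  (* Outside the support of [h] the coefficient is 0, and no word of the support matches [f]. *)
  case: (boolP (f \in msupp h)) => [fh|fh].
    rewrite (bigD1_seq f) //= big1 ?addr0 // => v vf.
    by rewrite /ev_word eq_sym (negbTE vf) !mulr0.
  rewrite (mcoeff_outdom fh) ginv0 mulr0 mul0r big1_seq // => v /= vh.
  rewrite /ev_word; case: eqP => [fv|_]; last by rewrite !mulr0.
  by rewrite fv vh in fh.
rewrite coef_tvecX fr ginvM ginv_sign ginv_even_prod andbb ev_wordff.
exact: mulr_signVK.
Qed.

End EvenPoint.

(** The lift chosen by [xget] and [g] differ by an element of the ideal, which the evaluation
    kills. *)
Lemma restitution_to_sym (F : fieldType) (B : finType) (par : B -> bool) r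
    (g : tensalg F par) (w : even_part F par) :
  in_tdeg r g -> restitution r (to_sym g) w = eval_even (val w) g.
Proof.
move=> hg; rewrite /restitution; set A := [set _ | _]%classic.
(* [g] itself is a lift of the right degree, so the default 0 does not occur. *)
have [h1 h2] : A (xget 0 A) by apply: xgetPex; exists g.
rewrite (ev_tvecX (valP w) h1); move/to_sym_eq: h2.
move/(eval_even_super_ideal (valP w)).
rewrite eval_evenD eval_evenN => /eqP; rewrite subr_eq0 => /eqP //.
Qed.

(** * The lift of the picture invariant to the tensor algebra *)

Lemma index_enumE (I : finType) : index_enum I = enum I.
Proof. by rewrite [index_enum I]unlock -enumT. Qed.

(** * The factors (i, j) of a picture in lexicographic order *)

Section Slots.
Variables (s : nat) (mult : 'I_s -> nat).
Local Notation slot := {i : 'I_s & 'I_(mult i)}.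

Lemma enum_slot :
  enum {: slot} =
  flatten [seq [seq Tagged (fun i => 'I_(mult i)) j | j <- enum 'I_(mult i)] | i <- enum 'I_s].
Proof.
rewrite [in LHS]enumT [in LHS]unlock; congr flatten; rewrite enumT.
by apply: eq_map => i; rewrite enumT.
Qed.

Lemma pairwise_slots : pairwise (@slot_lt s mult) (enum {: slot}).
Proof.
rewrite enum_slot; elim: (enum 'I_s) (@pairwise_enum_ord s) => //= i e IH /andP[ie /IH IHe].
rewrite pairwise_cat IHe andbT pairwise_map.
apply/andP; split.
  apply/allrelP => _ _ /mapP[j _ ->] /flattenP[_ /mapP[i' i'e ->] /mapP[j' _ ->]].
  by rewrite /slot_lt /= (allP ie).
apply: sub_pairwise (@pairwise_enum_ord (mult i)) => j j' jj'.
by rewrite /slot_lt /= eqxx jj' orbT.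
Qed.

Lemma slot_lt_asym (x y : slot) : slot_lt x y -> ~~ slot_lt y x.
Proof.
rewrite /slot_lt => /orP[lt|/andP[/eqP e lt]].
  by rewrite negb_or -leqNgt (ltnW lt) /= negb_and eq_sym -val_eqE neq_ltn lt.
by rewrite negb_or negb_and -!leqNgt (eq_leq (congr1 val e)) (ltnW lt) orbT.
Qed.

Lemma pair_sum_slots (R : slot -> slot -> nat) :
  pair_sum R (enum {: slot}) = (\sum_(x : slot) \sum_(y : slot | slot_lt x y) R x y)%N.
Proof.
rewrite (pair_sumE _ pairwise_slots slot_lt_asym) big_enum.
by apply: eq_bigr => x _; rewrite big_enum_cond.
Qed.

(** Stated for a law that need not be commutative, since the factors of a picture term do not
    commute: the enumeration of the slots keeps their order. *)
Lemma big_slots (R : Type) (idx : R) (op : Monoid.law idx) (G : forall i, 'I_(mult i) -> R) :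
  \big[op/idx]_(i < s) \big[op/idx]_(j < mult i) G i j =
  \big[op/idx]_(x <- enum {: slot}) G (tag x) (tagged x).
Proof.
rewrite enum_slot big_flatten big_map -index_enumE; apply: eq_bigr => i _.
by rewrite big_map -index_enumE.
Qed.

Lemma count_tag_slots i : count (fun x : slot => tag x == i) (enum {: slot}) = mult i.
Proof.
rewrite -sum1_count big_enum_cond.
transitivity (\sum_(i' < s | i' == i) \sum_(j < mult i') 1)%N.
  by rewrite sig_big_dep; apply: eq_bigl => x; rewrite andbT.
by rewrite big_pred1_eq sum1_card card_ord.
Qed.

Lemma size_slots : size (enum {: slot}) = (\sum_i mult i)%N.
Proof.
rewrite -sum1_size -(big_slots _ (fun _ _ => 1%N)).
by apply: eq_bigr => i _; rewrite sum1_card card_ord.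
Qed.

End Slots.

Lemma prodr_sign (R : pzRingType) (I : Type) (r : seq I) (P : pred I) (e : I -> nat) :
  \prod_(i <- r | P i) (-1) ^+ e i = (-1) ^+ (\sum_(i <- r | P i) e i)%N :> R.
Proof. exact: prodrXr. Qed.

Section Picture.
Variables (m n s : nat) (b t mult : 'I_s -> nat) (N : nat) (F : fieldType).
Hypotheses (hb : (\sum_k mult k * b k)%N = N) (ht : (\sum_k mult k * t k)%N = N).
Variable sigma : 'S_N.
Local Notation slot := {i : 'I_s & 'I_(mult i)}.
Local Notation basis_vec := (Tagged (fun i => mbasis 'I_(m + n) (b i) (t i))).
Local Notation T := (tensalg F (@Wpar m n s b t)).

(** The basis vector of W whose dual vector is the factor of the picture term at the slot [x]. *)
Definition picture_letter (r : {ffun 'I_N -> 'I_(m + n)}) (x : slot) : Wbasis m n b t :=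
  basis_vec ([tuple r (sigma (position hb (tagged x) l)) | l < b (tag x)],
             [tuple r (position ht (tagged x) k) | k < t (tag x)]).

(** The exponents of gamma and of the sign with exponent q together. As a natural number it gives a
    sign in the Grassmann algebra as well as in the symmetric algebra. *)
Definition picture_exponent (r : {ffun 'I_N -> 'I_(m + n)}) : nat :=
  (\sum_(k < N) \sum_(l < N | (k < l) && (sigma l < sigma k))
      Upar (r (sigma k)) * Upar (r (sigma l)) + q_exponent hb ht sigma r)%N.

Definition picture_lift : T :=
  \sum_r << (-1) ^+ picture_exponent r *g map (picture_letter r) (enum {: slot}) >>.

Lemma prod_letters (I : Type) (f : I -> Wbasis m n b t) (xs : seq I) :
  \prod_(x <- xs) (<< 1 *g [:: f x] >> : T) = << 1 *g map f xs >>.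
Proof.
elim: xs => [|x xs IH]; first by rewrite big_nil.
by rewrite big_cons IH tmonM ginv1 mulr1.
Qed.

Lemma to_sym_picture_lift : to_sym picture_lift = picture m n F hb ht sigma.
Proof.
rewrite /picture_lift raddf_sum; apply: eq_bigr => r _.
(* The sign is taken out and the word cut into single letters, so that the morphism [to_sym] acts on
   each factor. *)
rewrite -[X in << X *g _ >>]mulr1 -tmon_sign -prod_letters /=.
rewrite rmorphM rmorph_sign rmorph_prod.
apply: esym; apply: (congr2 *%R).
  rewrite /picture_exponent exprD; congr (_ * _).
  by rewrite -prodr_sign; apply: eq_bigr => k _; apply: prodr_sign.
exact: (big_slots *%R (fun i (j : 'I_(mult i)) =>
  to_sym (<< 1 *g [:: picture_letter r (Tagged (fun i => 'I_(mult i)) j)] >> : T))).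
Qed.

End Picture.

(** * Positions of the factors *)

(** The elements [y] of [xs] with [r y x] are those preceding [x], so each block starts where the
    previous one ends. *)
Lemma flatten_iota_offsets (T : eqType) (r : rel T) (c : T -> nat) (xs : seq T) a :
  pairwise r xs -> (forall x y, r x y -> ~~ r y x) ->
  flatten [seq iota (a + \sum_(y <- xs | r y x) c y)%N (c x) | x <- xs] =
  iota a (\sum_(x <- xs) c x)%N.
Proof.
move=> + asym; have irr x : r x x = false.
  by apply/negP => rx; move: (asym _ _ rx); rewrite rx.
elim: xs a => [|x xs IH] a /=; first by rewrite big_nil.
case/andP => /allP rx /IH {}IH; rewrite !big_cons irr iotaD -IH; congr (iota _ _ ++ flatten _).
  by rewrite big1_seq ?addn0 // => y /andP[ryx /rx /asym]; rewrite ryx.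
by apply/eq_in_map => y /rx rxy; rewrite big_cons rxy addnA.
Qed.

Section Positions.
Variables (s : nat) (mult c : 'I_s -> nat) (N : nat).
Hypothesis hc : (\sum_k mult k * c k)%N = N.
Local Notation slot := {i : 'I_s & 'I_(mult i)}.

(** The earlier slots are all the copies of earlier summands and the earlier copies of the same
    summand. *)
Lemma offset_slot (x : slot) :
  offset mult c (tag x) (tagged x) = (\sum_(y : slot | slot_lt y x) c (tag y))%N.
Proof.
rewrite (bigID (fun y : slot => (tag y < tag x)%N)) /= /offset; congr (_ + _)%N.
  transitivity (\sum_(p < s | p < tag x) \sum_(j < mult p) c p)%N.
    by apply: eq_bigr => p _; rewrite sum_nat_const card_ord.
  rewrite sig_big_dep; apply: eq_bigl => y.
  by rewrite /slot_lt; case: (tag y < tag x)%N; rewrite ?andbF.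
transitivity (\sum_(p < s | p == tag x) \sum_(j < mult p | j < tagged x) c p)%N.
  rewrite big_pred1_eq -(big_ord_widen _ (fun=> c (tag x)) (ltnW (ltn_ord _))).
  by rewrite sum_nat_const card_ord.
rewrite sig_big_dep; apply: eq_bigl => y.
rewrite /slot_lt; case: (tag y =P tag x) => [e|_] /=; last by case: ltnP.
have -> : (tag y < tag x)%N = false by rewrite e ltnn.
by rewrite andbT.
Qed.

(** The blocks of the successive slots tile 0, ..., N - 1, so [position] numbers all pairs of a slot
    and an index consecutively. *)
Lemma enum_positions :
  enum 'I_N = flatten [seq [seq position hc (tagged x) l | l <- enum 'I_(c (tag x))]
                      | x <- enum {: slot}].
Proof.
apply: (inj_map val_inj); rewrite val_enum_ord map_flatten -map_comp.
transitivity (iota 0 (\sum_(x <- enum {: slot}) c (tag x))).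
  rewrite -(big_slots _ (fun i _ => c i)) -hc; congr iota.
  by apply: eq_bigr => i _; rewrite sum_nat_const card_ord.
rewrite -(flatten_iota_offsets _ _ (pairwise_slots mult) (@slot_lt_asym _ mult)).
congr flatten; apply: eq_map => x /=.
rewrite add0n big_enum_cond -offset_slot.
rewrite -[offset _ _ _ _]addn0 iotaDl -val_enum_ord -!map_comp.
by [].
Qed.

Lemma map_positions (T : Type) (f : 'I_N -> T) :
  [seq f k | k <- enum 'I_N] =
  flatten [seq [seq f (position hc (tagged x) l) | l <- enum 'I_(c (tag x))]
          | x <- enum {: slot}].
Proof.
rewrite [in LHS]enum_positions map_flatten -map_comp; congr flatten.
by apply: eq_map => x /=; rewrite -map_comp.
Qed.

End Positions.

(** * Koszul signs of the rearrangements *)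

Section Onth.
Local Open Scope nat_scope.

Lemma onth_enum_ord (T : Type) N (f : 'I_N -> T) (k : 'I_N) :
  onth [seq f i | i <- enum 'I_N] k = Some (f k).
Proof.
by rewrite onth_map onthE (nth_map k) ?size_enum_ord ?ltn_ord //= nth_ord_enum.
Qed.

Lemma onth_cat_enum_ord (T : Type) N (f g : 'I_N -> T) (k : 'I_N) :
  onth ([seq f i | i <- enum 'I_N] ++ [seq g i | i <- enum 'I_N]) k = Some (f k) /\
  onth ([seq f i | i <- enum 'I_N] ++ [seq g i | i <- enum 'I_N]) (N + k) = Some (g k).
Proof.
rewrite !onth_cat size_map size_enum_ord ltn_ord onth_enum_ord.
by rewrite ltnNge leq_addr /= addKn onth_enum_ord.
Qed.

Lemma onth_flatten_pairs (T S : Type) (f g : T -> S) (xs : seq T) i :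
  onth (flatten [seq [:: f x; g x] | x <- xs]) i.*2 = omap f (onth xs i) /\
  onth (flatten [seq [:: f x; g x] | x <- xs]) i.*2.+1 = omap g (onth xs i).
Proof. by elim: xs i => [|x xs IH] [|i] //=; apply: IH. Qed.

Lemma onth_pairs_enum_ord (T : Type) N (f g : 'I_N -> T) (k : 'I_N) :
  onth (flatten [seq [:: f i; g i] | i <- enum 'I_N]) k.*2 = Some (f k) /\
  onth (flatten [seq [:: f i; g i] | i <- enum 'I_N]) k.*2.+1 = Some (g k).
Proof.
have [-> ->] := onth_flatten_pairs f g (enum 'I_N) k.
by rewrite -!(onth_map (nat_of_ord k)) !onth_enum_ord.
Qed.

Lemma pmap_onth_map (I T : Type) (w : seq T) (g : I -> nat) (h : I -> T) xs :
  (forall k, onth w (g k) = Some (h k)) -> pmap (onth w) (map g xs) = map h xs.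
Proof. by move=> gh; elim: xs => //= k xs ->; rewrite gh. Qed.

Lemma pmap_onth_pairs (I T : Type) (w : seq T) (g g' : I -> nat) (h h' : I -> T) xs :
  (forall k, onth w (g k) = Some (h k)) ->
  (forall k, onth w (g' k) = Some (h' k)) ->
  pmap (onth w) (flatten [seq [:: g k; g' k] | k <- xs]) =
  flatten [seq [:: h k; h' k] | k <- xs].
Proof. by move=> gh gh'; elim: xs => //= k xs ->; rewrite gh gh'. Qed.

Lemma nth_map_onth (T S : Type) (y0 : S) (f : T -> S) (w : seq T) i c :
  onth w i = Some c -> nth y0 (map f w) i = f c.
Proof.
move=> wi; have iw : i < size w by rewrite -onthTE wi.
by rewrite (nth_map c) //; congr f; apply: onth_nth.
Qed.

Lemma iota_shift_ord N : iota N N = [seq N + k | k : 'I_N <- enum 'I_N].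
Proof. by rewrite -{1}[N]addn0 iotaDl -val_enum_ord -map_comp. Qed.

End Onth.

Section Koszul.
Variables (B : finType) (par : B -> bool) (N : nat).
Local Open Scope nat_scope.
Implicit Types f g : 'I_N -> B.

Local Notation kR w := (fun i j => if (j < i)%N
  then (nth false (map par w) i * nth false (map par w) j)%N else 0%N).

(** The last N factors stay in place behind the others, so only the inversions of [sg] count. *)
Lemma koszul_block_perm (sg : 'I_N -> 'I_N) f g :
  koszul par ([seq val (sg k) | k <- enum 'I_N] ++ iota N N)
    ([seq f i | i <- enum 'I_N] ++ [seq g i | i <- enum 'I_N]) =
  \sum_(k < N) \sum_(l < N | (k < l) && (sg l < sg k)) par (f (sg k)) * par (f (sg l)).
Proof.
rewrite koszulE; set w := _ ++ [seq g i | i <- _].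
have wl (k : 'I_N) : nth false (map par w) k = par (f k).
  by apply: nth_map_onth; case: (onth_cat_enum_ord f g k).
rewrite pair_sum_cat [X in _ + X + _](pair_sum_eq0 (pairwise_ltn_iota N N)); last first.
  by move=> i j /= ij; rewrite ltnNge (ltnW ij).
rewrite [X in _ + X]big1_seq ?addn0 => [|i /mapP[k _ ->]]; last first.
  rewrite big1_seq // => j; rewrite mem_iota => /and3P[_ Nj _].
  by rewrite ltnNge (leq_trans (ltnW (ltn_ord _)) Nj).
rewrite pair_sum_map pair_sum_ord; apply: eq_bigr => k _.
by rewrite [RHS]big_mkcondr; apply: eq_bigr => l _; rewrite !wl.
Qed.

(** The k-th factor of the second block passes exactly the factors l > k of the first block. *)
Lemma koszul_shuffle f g :
  koszul par (flatten [seq [:: k; N + k] | k <- iota 0 N])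
    ([seq f i | i <- enum 'I_N] ++ [seq g i | i <- enum 'I_N]) =
  \sum_(k < N) \sum_(l < N | k < l) par (g k) * par (f l).
Proof.
rewrite koszulE; set w := _ ++ [seq g i | i <- _].
have wl (k : 'I_N) : nth false (map par w) k = par (f k).
  by apply: nth_map_onth; case: (onth_cat_enum_ord f g k).
have wr (k : 'I_N) : nth false (map par w) (N + k) = par (g k).
  by apply: nth_map_onth; case: (onth_cat_enum_ord f g k).
rewrite -val_enum_ord -map_comp pair_sum_flatten big_map big1 ?addn0 => [|k _]; last first.
  by rewrite /= !big_seq1 !big_nil ltnNge ltnW // (leq_trans (ltn_ord k)) ?leq_addr.
rewrite pair_sum_map pair_sum_ord; apply: eq_bigr => k _; apply: eq_bigr => l kl.
rewrite /= !big_cons !big_nil !addn0 ltn_add2l !wr !wl.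
have -> : (l < k) = false by rewrite ltnNge ltnW.
have -> : (N + l < k) = false.
  by rewrite ltnNge (leq_trans (ltnW (ltn_ord k))) ?leq_addr.
by rewrite (leq_trans (ltn_ord l) (leq_addr k N)) add0n addn0.
Qed.

Lemma koszul_swap f g :
  koszul par (flatten [seq [:: k.*2.+1; k.*2] | k <- iota 0 N])
    (flatten [seq [:: f i; g i] | i <- enum 'I_N]) =
  \sum_(k < N) par (g k) * par (f k).
Proof.
rewrite koszulE; set w := flatten [seq [:: f i; g i] | i <- _].
have wl (k : 'I_N) : nth false (map par w) k.*2 = par (f k).
  by apply: nth_map_onth; case: (onth_pairs_enum_ord f g k).
have wr (k : 'I_N) : nth false (map par w) k.*2.+1 = par (g k).
  by apply: nth_map_onth; case: (onth_pairs_enum_ord f g k).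
rewrite -val_enum_ord -map_comp pair_sum_flatten big_map.
rewrite pair_sum_map (pair_sum_eq0 (@pairwise_enum_ord N)) => [|k l kl].
  rewrite add0n big_enum; apply: eq_bigr => k _ /=.
  by rewrite !big_seq1 !big_nil !addn0 ltnSn wl wr.
rewrite /= !big_cons !big_nil.
(* For k < l both positions of the k-th pair lie before both of the l-th, so distinct pairs give no
   inversion. *)
by repeat (rewrite ifF; last by apply/negP; lia).
Qed.

End Koszul.

(** * Rearrangements on monomials, and the sign of mu *)

Section Rearrange.
Variables (F : fieldType) (B : finType) (par : B -> bool).
Local Notation T := (tensalg F par).

Lemma rearrangeD p : {morph @rearrange F B par p : x y / x + y}.
Proof.
by apply: (mextD (F := fun w a => << a * (-1) ^+ koszul par (p w) w *g pmap (onth w) (p w) >>))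
  => w x y; rewrite mulrDl monalgUD.
Qed.

Lemma rearrangeU p w a :
  rearrange p (<< a *g w >> : T) =
  << a * (-1) ^+ koszul par (p w) w *g pmap (onth w) (p w) >>.
Proof.
by apply: (mextU (F := fun w a => << a * (-1) ^+ koszul par (p w) w *g pmap (onth w) (p w) >>))
  => v x y; rewrite mulrDl monalgUD.
Qed.

End Rearrange.

(** The predicate is on options because [mu_pos] tests letters through [onth]. *)
Lemma pmap_onth_filter (T : Type) (P : option T -> bool) (w : seq T) :
  pmap (onth w) [seq k <- iota 0 (size w) | P (onth w k)] = [seq x <- w | P (Some x)].
Proof.
elim: w => //= x w IH; rewrite -IH (iotaDl 1 0) filter_map.
have E s : pmap (onth (x :: w)) (map (addn 1) s) = pmap (onth w) s.
  by elim: s => //= k s ->.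
by case: (P (Some x)) => /=; rewrite E.
Qed.

Section Mixed.
Variables (F : fieldType) (E : finType) (par : E -> bool).
Local Notation L := (grassmann F).
Local Notation T := (tensalg F (mixed_par par)).
Local Notation letter := (E + E)%type.
Local Notation isU := (fun c : letter => if c is inl _ then true else false).

Lemma pmap_mu_pos (w : seq letter) :
  pmap (onth w) (mu_pos w) = [seq c <- w | isU c] ++ [seq c <- w | ~~ isU c].
Proof.
rewrite /mu_pos pmap_cat.
rewrite (pmap_onth_filter (fun c => if c is Some (inl _) then true else false)).
by rewrite (pmap_onth_filter (fun c => ~~ (if c is Some (inl _) then true else false))).
Qed.

(** Both blocks of [mu_pos] are increasing, so an inversion is a dual factor that stood before a
    U-factor in [w]. *)
Lemma koszul_mu_pos (w : seq letter) :
  koszul (mixed_par par) (mu_pos w) w =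
  pair_sum (fun c d => if ~~ isU c && isU d
                       then mixed_par par c * mixed_par par d else 0)%N w.
Proof.
rewrite koszulE; pose P k := if onth w k is Some (inl _) then true else false.
pose Q k := ~~ P k; pose s := iota 0 (size w).
have -> : mu_pos w = filter P s ++ filter Q s by [].
have ps0 (p : pred nat) : pairwise ltn (filter p s).
  by apply: pairwise_filter; apply: pairwise_ltn_iota.
rewrite pair_sum_cat.
rewrite (pair_sum_eq0 (ps0 P)); last by move=> i j /= ij; rewrite ltnNge (ltnW ij).
rewrite (pair_sum_eq0 (ps0 Q)); last by move=> i j /= ij; rewrite ltnNge (ltnW ij).
rewrite !add0n exchange_big big_filter /=.
under eq_bigr => i _ do rewrite big_filter.
(* The empty word is set apart to have a default letter [c0] for [nth]. *)
case: w @P @Q @s {ps0} => [|c0 w0] P Q s; first by rewrite /s big_nil.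
move: @P @Q @s; set w := c0 :: w0 => P Q s.
have wE : w = [seq nth c0 w i | i <- s] by rewrite map_nth_iota0 // take_size.
rewrite [X in pair_sum _ X]wE pair_sum_map.
rewrite (pair_sumE _ (pairwise_ltn_iota 0 (size w))) => [|i j /= ij]; last first.
  by rewrite -leqNgt ltnW.
have Pn i : i \in s -> P i = isU (nth c0 w i).
  rewrite mem_iota /P => /andP[_ iw].
  by rewrite onthE (nth_map c0) //.
rewrite -/s big_mkcond; apply: eq_big_seq => i iN.
rewrite /Q Pn //; case: (isU (nth c0 w i)) => /=; first by rewrite big1_eq.
rewrite big_mkcond [RHS]big_mkcond; apply: eq_big_seq => j jN.
rewrite Pn //; case: (isU (nth c0 w j)) => //=; last by rewrite if_same.
case: ifP => // _; rewrite mulnC; congr (_ * _)%N; congr nat_of_bool;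
  apply: (@nth_map _ c0 _ false (mixed_par par) _ w).
  by move: iN; rewrite mem_iota.
by move: jN; rewrite mem_iota.
Qed.

End Mixed.

(** * The map T_sigma on words *)

(** Collects the signs of mu, sigma, tau and nu; the exponent of sigma may be rewritten on the
    way. *)
Lemma mulr_sign4 (R : pzRingType) (a x : R) (d d' e f g : nat) : d = d' ->
  a * (-1) ^+ e * (-1) ^+ d * (-1) ^+ f * (-1) ^+ g * x =
  a * (-1) ^+ (e + d' + f + g) * x.
Proof. by move=> ->; rewrite !exprD !mulrA. Qed.

Section MixedWords.
Variables (F : fieldType) (E : finType) (par : E -> bool).
Local Notation L := (grassmann F).
Local Notation T := (tensalg F (mixed_par par)).
Local Notation letter := (E + E)%type.
Local Notation isU := (fun c : letter => if c is inl _ then true else false).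

(** Lists instead of tuples allow factors from summands with different b and t in one list. *)
Definition mword (p : seq E * seq E) : seq letter := map inl p.1 ++ map inr p.2.

Lemma filter_mwords (ps : seq (seq E * seq E)) :
  [seq c <- flatten (map mword ps) | isU c] = map inl (flatten (map fst ps)) /\
  [seq c <- flatten (map mword ps) | ~~ isU c] = map inr (flatten (map snd ps)).
Proof.
have Ul (u : seq E) : [seq c <- map inl u | isU c] = map inl u by elim: u => //= x u ->.
have Ur (u : seq E) : [seq c <- map inr u | isU c] = [::] by elim: u.
have Dl (u : seq E) : [seq c <- map inl u | ~~ isU c] = [::] by elim: u.
have Dr (u : seq E) : [seq c <- map inr u | ~~ isU c] = map inr u by elim: u => //= x u ->.
elim: ps => [|p ps [IH1 IH2]] //; split.
  by rewrite [LHS]filter_cat IH1 filter_cat Ul Ur cats0 [in RHS]/= map_cat.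
by rewrite [LHS]filter_cat IH2 filter_cat Dl Dr [in RHS]/= map_cat.
Qed.

(** Within one factor the U-letters already come first, so only dual letters of an earlier factor
    and U-letters of a later one are interchanged. *)
Lemma koszul_mu_mwords (ps : seq (seq E * seq E)) :
  koszul (mixed_par par) (mu_pos (flatten (map mword ps))) (flatten (map mword ps)) =
  pair_sum (fun p q => count par p.2 * count par q.1)%N ps.
Proof.
rewrite koszul_mu_pos pair_sum_flatten big_map pair_sum_map big1 => [|p _].
  rewrite addn0; congr (pair_sum _ _); apply/funext => p; apply/funext => q.
  rewrite big_cat !big_map /= big1 ?add0n => [|c _]; last by rewrite big1.
  rewrite -[count par p.2]sum1_count big_distrl [RHS]big_mkcond; apply: eq_bigr => c _.
  rewrite big_cat !big_map /= [X in (_ + X)%N]big1 ?addn0 // big_parM.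
  by case: (par c); rewrite ?mul1n ?mul0n.
rewrite pair_sum_cat !pair_sum_map /=.
rewrite (pair_sum_eq0 (r := fun _ _ => true)) //; last first.
  by elim: (p.1) => //= x s ->; rewrite all_predT.
rewrite (pair_sum_eq0 (r := fun _ _ => true)) //; last first.
  by elim: (p.2) => //= x s ->; rewrite all_predT.
by rewrite big_map big1 // => c _; rewrite big1.
Qed.

Lemma contractD : {morph @contract F E par : x y / x + y}.
Proof. by apply: (mextD (F := fun w a => a * contract_word F w)) => w x y; rewrite mulrDl. Qed.

Lemma contractU w a : contract (<< a *g w >> : T) = a * contract_word F w.
Proof. by apply: (mextU (F := fun w a => a * contract_word F w)) => v x y; rewrite mulrDl. Qed.

Lemma contract_word_pairs (I : Type) (f g : I -> E) (xs : seq I) :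
  contract_word F (flatten [seq [:: inr (f i); inl (g i)] | i <- xs]) =
  (all (fun i => f i == g i) xs)%:R.
Proof. by elim: xs => //= i xs ->; rewrite -natrM mulnb. Qed.

Variables (N : nat) (sigma : 'S_N).

Lemma T_sigmaD : {morph @T_sigma F E par N sigma : x y / x + y}.
Proof.
move=> x y; rewrite /T_sigma.
apply: etrans (contractD _ _); congr (contract _).
by do 3![apply: etrans (rearrangeD _ _ _); congr (rearrange _ _)]; apply: rearrangeD.
Qed.

Section Rearrangements.
Variables (f g : 'I_N -> letter).
Local Notation mpar := (mixed_par par).

Lemma rearrange_sigma_pos (a : L) :
  rearrange (sigma_pos sigma)
    (<< a *g [seq f k | k <- enum 'I_N] ++ [seq g k | k <- enum 'I_N] >> : T) =
  << a * (-1) ^+ (\sum_(k < N) \sum_(l < N | (k < l) && ((sigma^-1)%g l < (sigma^-1)%g k))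
                   mpar (f ((sigma^-1)%g k)) * mpar (f ((sigma^-1)%g l)))%N
     *g [seq f ((sigma^-1)%g k) | k <- enum 'I_N] ++ [seq g k | k <- enum 'I_N] >>.
Proof.
rewrite rearrangeU /sigma_pos koszul_block_perm pmap_cat iota_shift_ord.
have fg := onth_cat_enum_ord f g.
rewrite (pmap_onth_map (h := fun k => f ((sigma^-1)%g k))) => [|k];
  last by case: (fg ((sigma^-1)%g k)).
by rewrite (pmap_onth_map (h := g)) => [|k]; last by case: (fg k).
Qed.

Lemma rearrange_tau_pos (a : L) :
  rearrange (@tau_pos E N)
    (<< a *g [seq f k | k <- enum 'I_N] ++ [seq g k | k <- enum 'I_N] >> : T) =
  << a * (-1) ^+ (\sum_(k < N) \sum_(l < N | k < l) mpar (g k) * mpar (f l))%N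
     *g flatten [seq [:: f k; g k] | k <- enum 'I_N] >>.
Proof.
rewrite rearrangeU /tau_pos koszul_shuffle -val_enum_ord -map_comp.
have fg := onth_cat_enum_ord f g.
by rewrite (pmap_onth_pairs (h := f) (h' := g)) => // k; case: (fg k).
Qed.

Lemma rearrange_nu_pos (a : L) :
  rearrange (@nu_pos E N)
    (<< a *g flatten [seq [:: f k; g k] | k <- enum 'I_N] >> : T) =
  << a * (-1) ^+ (\sum_(k < N) mpar (g k) * mpar (f k))%N
     *g flatten [seq [:: g k; f k] | k <- enum 'I_N] >>.
Proof.
rewrite rearrangeU /nu_pos koszul_swap -val_enum_ord -map_comp.
have fg := onth_pairs_enum_ord f g.
by rewrite (pmap_onth_pairs (h := g) (h' := f)) => // k; case: (fg k).
Qed.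

End Rearrangements.

(** The four summands of the exponent come from mu, sigma, tau and nu in this order; the last factor
    is the contraction, which requires the k-th dual letter to match the U-letter that sigma moves
    to place k. *)
Lemma T_sigma_mwords (a : L) ps (uf df : 'I_N -> E) :
  flatten (map fst ps) = [seq uf k | k <- enum 'I_N] ->
  flatten (map snd ps) = [seq df k | k <- enum 'I_N] ->
  T_sigma sigma (<< a *g flatten (map mword ps) >> : T) =
  a * (-1) ^+ (pair_sum (fun p q => count par p.2 * count par q.1) ps
      + \sum_(k < N) \sum_(l < N | (sigma k < sigma l) && (l < k)) par (uf k) * par (uf l)
      + \sum_(k < N) \sum_(l < N | k < l) par (df k) * par (uf ((sigma^-1)%g l))
      + \sum_(k < N) par (df k) * par (uf ((sigma^-1)%g k)))%N
  * (all (fun k => df k == uf ((sigma^-1)%g k)) (enum 'I_N))%:R.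
Proof.
move=> ufE dfE.
pose f := inl \o uf : 'I_N -> letter; pose g := inr \o df : 'I_N -> letter.
have [fU fD] := filter_mwords ps.
rewrite /T_sigma rearrangeU koszul_mu_mwords pmap_mu_pos fU fD ufE dfE.
rewrite -2!map_comp -/f -/g rearrange_sigma_pos rearrange_tau_pos rearrange_nu_pos.
rewrite contractU contract_word_pairs; apply: mulr_sign4.
(* Substituting sigma for both indices turns the inversions of its inverse into those of sigma. *)
rewrite (reindex_inj (@perm_inj _ sigma)); apply: eq_bigr => k _.
rewrite (reindex_inj (@perm_inj _ sigma)); apply: eq_big => l.
  by rewrite !permK.
by rewrite !permK.
Qed.

End MixedWords.

Lemma msupp_sum_mon (K : choiceType) (G : zmodType) (I : finType)
    (g : I -> K) (a : I -> G) k :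
  k \in msupp (\sum_i << a i *g g i >>) -> exists i, k = g i.
Proof.
rewrite -mcoeff_neq0 raddf_sum /= => /negP sk.
apply/not_existsP => kg; apply: sk; rewrite big1 // => i _.
by rewrite mcoeffU; case: eqP => // gk; case: (kg i).
Qed.

Lemma odd_pair_sum (T : Type) (R R' : T -> T -> nat) xs :
  (forall x y, odd (R x y) = odd (R' x y)) ->
  odd (pair_sum R xs) = odd (pair_sum R' xs).
Proof.
move=> RR'; elim: xs => //= x xs IH; rewrite !oddD IH; congr addb.
by rewrite !(big_morph odd oddD (erefl (odd 0))); apply: eq_bigr.
Qed.

(** * Sums over the positions before a given slot *)

Section OffsetSums.
Variables (s : nat) (mult c : 'I_s -> nat) (N : nat).
Hypothesis hc : (\sum_k mult k * c k)%N = N.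
Local Notation slot := {i : 'I_s & 'I_(mult i)}.

(** By [offset_slot] the left side sums over [x] and the slots before it, and all of these precede
    [y]. *)
Lemma offset_mono (x y : slot) : slot_lt x y ->
  (offset mult c (tag x) (tagged x) + c (tag x) <= offset mult c (tag y) (tagged y))%N.
Proof.
move=> xy; rewrite !offset_slot [leqRHS](bigD1 x) //= addnC leq_add2l.
rewrite [leqRHS]big_mkcond [leqLHS]big_mkcond; apply: leq_sum => z _.
case: ifP => // zx; rewrite ifT //; apply/andP; split.
  by move: zx xy; rewrite /slot_lt -!val_eqE /=; lia.
by apply: contraTneq zx => ->; apply/negP => xx; move: (slot_lt_asym xx); rewrite xx.
Qed.

Lemma slot_lt_total (x y : slot) : [|| slot_lt x y, slot_lt y x | x == y].
Proof.
case: x y => [i j] [i' j']; rewrite /slot_lt /=.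
case: (ltngtP i i') => [||/val_inj e]; rewrite ?orbT //.
case: _ / e j' => j'; rewrite eqxx eq_Tagged /=.
by case: (ltngtP j j') => [||/val_inj ->]; rewrite ?eqxx ?orbT.
Qed.

(** If [x] does not precede [y], then it is [y] or follows it, and its block starts at or after that
    of [y]. *)
Lemma position_lt_offset (x y : slot) (l : 'I_(c (tag x))) :
  (position hc (tagged x) l < offset mult c (tag y) (tagged y))%N = slot_lt x y.
Proof.
rewrite /=; apply/idP/idP => [lt|/offset_mono le].
  case/or3P: (slot_lt_total x y) => [//|/offset_mono le|/eqP xy].
    by move: lt; rewrite ltnNge (leq_trans (leq_trans (leq_addr _ _) le)) ?leq_addr.
  by move: lt; rewrite -xy ltnNge leq_addr.
by apply: leq_trans le; rewrite ltn_add2l.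
Qed.

Lemma sum_positions (P : pred 'I_N) (a : 'I_N -> nat) :
  (\sum_(k < N | P k) a k =
   \sum_(x : slot) \sum_(l < c (tag x) | P (position hc (tagged x) l))
      a (position hc (tagged x) l))%N.
Proof.
transitivity (\sum_(k <- enum 'I_N | P k) a k)%N; first by rewrite big_enum_cond.
rewrite (enum_positions hc) big_flatten big_map big_enum.
apply: eq_bigr => x _; rewrite big_map big_enum_cond; exact: eq_bigl.
Qed.

(** Turns the inner sum of q over k up to C(i,j) into a sum over earlier slots, the form in which
    the sign of mu appears. *)
Lemma sum_lt_offset (a : 'I_N -> nat) (y : slot) :
  (\sum_(k < N | k < offset mult c (tag y) (tagged y)) a k =
   \sum_(x : slot | slot_lt x y) \sum_(l < c (tag x)) a (position hc (tagged x) l))%N.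
Proof.
rewrite sum_positions [RHS]big_mkcond; apply: eq_bigr => x _.
by under eq_bigl => l do rewrite position_lt_offset; case: slot_lt; rewrite ?big_pred0_eq.
Qed.

End OffsetSums.

(** * Comparison of the signs *)

Lemma count_sum (T : Type) (p : pred T) xs : count p xs = (\sum_(x <- xs) p x)%N.
Proof. by rewrite -sum1_count big_mkcond. Qed.

Section PictureSigns.
Variables (m n s : nat) (b t mult : 'I_s -> nat) (N : nat).
Hypotheses (hb : (\sum_k mult k * b k)%N = N) (ht : (\sum_k mult k * t k)%N = N).
Variable sigma : 'S_N.
Local Notation slot := {i : 'I_s & 'I_(mult i)}.
Local Notation E := 'I_(m + n).
Local Notation par := (@Upar m n).
Local Notation W := (Wbasis m n b t).

Definition letter_pair (c : W) : seq E * seq E := (val (tagged c).1, val (tagged c).2).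

Lemma wpar_mword (c : W) : wpar (mixed_par par) (mword (letter_pair c)) = Wpar c.
Proof. by rewrite /wpar count_cat !count_map oddD. Qed.

Variable r : {ffun 'I_N -> E}.
Local Notation letter := (picture_letter hb ht sigma r).
Local Notation pairs := [seq letter_pair (letter x) | x <- enum {: slot}].

Lemma lower_letter x :
  (letter_pair (letter x)).1 =
  [seq r (sigma (position hb (tagged x) l)) | l <- enum 'I_(b (tag x))].
Proof. by []. Qed.

Lemma upper_letter x :
  (letter_pair (letter x)).2 =
  [seq r (position ht (tagged x) l) | l <- enum 'I_(t (tag x))].
Proof. by []. Qed.

Lemma flatten_lower : flatten (map fst pairs) = [seq r (sigma k) | k <- enum 'I_N].
Proof. by rewrite (map_positions hb) -map_comp. Qed.

Lemma flatten_upper : flatten (map snd pairs) = [seq r k | k <- enum 'I_N].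
Proof. by rewrite (map_positions ht) -map_comp. Qed.

Lemma count_lower x :
  count par (letter_pair (letter x)).1 = lower_deg hb sigma r x.
Proof. by rewrite lower_letter count_sum big_map big_enum. Qed.

Lemma count_upper x :
  count par (letter_pair (letter x)).2 =
  (\sum_(k < t (tag x)) par (r (position ht (tagged x) k)))%N.
Proof. by rewrite upper_letter count_sum big_map big_enum. Qed.

Lemma Wpar_letter x : Wpar (letter x) = odd (factor_deg hb ht sigma r x).
Proof.
by rewrite /factor_deg -count_lower -count_upper oddD.
Qed.

(** The upper indices contribute the parities of all r_k, the lower ones those of all r_(sigma k);
    these sums are equal. This removes the parity sign of [eval_even]. *)
Lemma wpar_letters : wpar (@Wpar m n s b t) (map letter (enum {: slot})) = false.
Proof.
rewrite /wpar count_map count_sum.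
have -> : odd (\sum_(x <- enum {: slot}) Wpar (letter x)) =
          odd (\sum_(x <- enum {: slot}) factor_deg hb ht sigma r x).
  rewrite !(big_morph odd oddD (erefl (odd 0))); apply: eq_bigr => x _.
  by rewrite oddb Wpar_letter.
rewrite /factor_deg big_split /=.
rewrite (eq_bigr (fun x => count par (letter_pair (letter x)).1)) => [|x _];
  last by rewrite count_lower.
rewrite [X in (_ + X)%N](eq_bigr (fun x => count par (letter_pair (letter x)).2)) => [|x _];
  last by rewrite count_upper.
have cf (g : seq E * seq E -> seq E) :
    (\sum_(x <- enum {: slot}) count par (g (letter_pair (letter x))))%N
    = count par (flatten (map g pairs)).
  by rewrite count_flatten sumnE !big_map.
rewrite (cf fst) (cf snd) flatten_lower flatten_upper !count_sum 2!big_map !big_enum /=.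
rewrite [X in (_ + X)%N](reindex_inj (@perm_inj _ sigma)) /=.
by rewrite addnn odd_double.
Qed.

(** Only parities are compared, as [Wpar] keeps the degree d_(i,j) modulo 2. *)
Lemma wsign_letters :
  odd (wsign (@Wpar m n s b t) (map letter (enum {: slot}))) =
  odd (\sum_(x : slot) \sum_(y : slot | slot_lt x y)
         factor_deg hb ht sigma r x * factor_deg hb ht sigma r y).
Proof.
rewrite -pair_sum_slots /wsign pair_sum_map; apply: odd_pair_sum => x y.
by rewrite !oddM !Wpar_letter !oddb.
Qed.

(** The pairs of slots are grouped by the later one, whose U-letters pass all earlier dual
    letters. *)
Lemma mu_letters :
  pair_sum (fun p q => count par p.2 * count par q.1)%N pairs =
  (\sum_(x : slot) lower_deg hb sigma r x *
     (\sum_(k < N | k < offset mult t (tag x) (tagged x)) par (r k)))%N.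
Proof.
rewrite pair_sum_map pair_sum_slots (exchange_big_dep predT) //=; apply: eq_bigr => y _.
rewrite (sum_lt_offset ht) big_distrr; apply: eq_bigr => x _ /=.
by rewrite mulnC -count_lower -count_upper.
Qed.

Lemma picture_signs :
  odd (picture_exponent hb ht sigma r) =
  odd (wsign (@Wpar m n s b t) (map letter (enum {: slot})) +
      (pair_sum (fun p q => count par p.2 * count par q.1) pairs
      + \sum_(k < N) \sum_(l < N | (sigma k < sigma l) && (l < k))
            par (r (sigma k)) * par (r (sigma l))
      + \sum_(k < N) \sum_(l < N | k < l) par (r k) * par (r (sigma ((sigma^-1)%g l)))
      + \sum_(k < N) par (r k) * par (r (sigma ((sigma^-1)%g k)))))%N.
Proof.
rewrite mu_letters [RHS]oddD wsign_letters -oddD; congr odd.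
rewrite /picture_exponent /q_exponent.
(* The same inversions of sigma, with the two members of each pair exchanged. *)
have -> : (\sum_(k < N) \sum_(l < N | (sigma k < sigma l) && (l < k))
    par (r (sigma k)) * par (r (sigma l)) =
  \sum_(k < N) \sum_(l < N | (k < l) && (sigma l < sigma k))
    par (r (sigma k)) * par (r (sigma l)))%N.
  rewrite (exchange_big_dep predT) //=; apply: eq_bigr => k _.
  by apply: eq_big => [l|l _]; [rewrite andbC | rewrite mulnC].
(* A parity equals its own square. *)
have -> : (\sum_(k < N) par (r k) * par (r (sigma ((sigma^-1)%g k))) = \sum_(k < N) par (r k))%N.
  by apply: eq_bigr => k _; rewrite permKV; case: (par _).
have -> : (\sum_(k < N) \sum_(l < N | k < l) par (r k) * par (r (sigma ((sigma^-1)%g l))) =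
   \sum_(k < N) \sum_(l < N | k < l) par (r k) * par (r l))%N.
  by apply: eq_bigr => k _; apply: eq_bigr => l _; rewrite permKV.
lia.
Qed.

End PictureSigns.

(** * Expansion of T_sigma *)

Lemma mulr_sign_odd (R : pzRingType) (d e f : nat) (x : R) : odd e = odd (d + f) ->
  (-1) ^+ d * x * (-1) ^+ f = (-1) ^+ e * x.
Proof.
move=> h; rewrite [LHS]commr_sign mulrA -exprD -[in LHS]signr_odd addnC -h.
by rewrite signr_odd.
Qed.

Section PictureEvaluation.
Variables (m n s : nat) (b t mult : 'I_s -> nat) (N : nat) (F : fieldType).
Hypotheses (hb : (\sum_k mult k * b k)%N = N) (ht : (\sum_k mult k * t k)%N = N).
Variable sigma : 'S_N.
Local Notation slot := {i : 'I_s & 'I_(mult i)}.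
Local Notation E := 'I_(m + n).
Local Notation par := (@Upar m n).
Local Notation W := (Wbasis m n b t).
Local Notation wpar_ := (@Wpar m n s b t).
Local Notation L := (grassmann F).
Local Notation T := (tensalg F (mixed_par par)).
Local Notation letter := (picture_letter hb ht sigma).

Lemma msupp_picture_lift v : v \in msupp (picture_lift m n F hb ht sigma) ->
  exists r, v = map (letter r) (enum {: slot}).
Proof. exact: msupp_sum_mon. Qed.

Lemma picture_lift_multidegree v : v \in msupp (picture_lift m n F hb ht sigma) ->
  forall i, count (fun c => tag c == i) v = mult i.
Proof.
by move=> /msupp_picture_lift[r ->] i; rewrite count_map -(count_tag_slots mult i).
Qed.

Lemma picture_lift_tdeg : in_tdeg (\sum_i mult i) (picture_lift m n F hb ht sigma).
Proof.
apply/allP => v /msupp_picture_lift[r ->] /=.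
by rewrite size_map size_slots.
Qed.

Variable w : {ffun W -> L}.
Hypothesis hw : vhomog wpar_ false w.

Definition summand (c : W) : T := << w c *g mword (letter_pair c) >>.

(** The word of [c] in U and its dual has the parity of [c] in W, so the sign is the one met in
    tensor powers over W. *)
Lemma prod_mwords (cs : seq W) :
  \prod_(c <- cs) summand c =
  << (-1) ^+ wsign wpar_ cs * \prod_(c <- cs) w c
     *g flatten (map (@mword E) (map (@letter_pair m n s b t) cs)) >>.
Proof.
elim: cs => [|c cs IH]; first by rewrite !big_nil mulr1.
rewrite big_cons IH; apply: etrans (tmonM _ _ _ _ _) _.
rewrite -(even_prod_cons hw) -wpar_mword.
reflexivity.
Qed.

(** The upper indices suffice: concatenated over the slots they are r_1, ..., r_N. *)
Lemma picture_letter_inj (r r' : {ffun 'I_N -> E}) :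
  {in enum {: slot}, letter r =1 letter r'} -> r = r'.
Proof.
move=> rr'; apply/ffunP => k.
have /eq_in_map -> // : [seq r k | k <- enum 'I_N] = [seq r' k | k <- enum 'I_N].
  rewrite -!(flatten_upper hb ht sigma); congr (flatten (map _ _)).
  by apply/eq_in_map => x /rr' ->.
by rewrite mem_enum.
Qed.

(** The tags are compared separately, as summands with equal b and t share their letter pairs. *)
Lemma letter_pair_inj (c d : W) : tag c = tag d -> letter_pair c = letter_pair d -> c = d.
Proof.
case: c d => [i [l u]] [i' [l' u']] /= e; case: _ / e l' u' => l' u'.
by case=> /val_inj -> /val_inj ->.
Qed.

(** A nonzero contraction forces the U-letters to be the dual letters permuted by sigma, and then
    the choice comes from the family of dual letters. *)
Lemma T_sigma_choice (f : slot -> W) :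
  (forall x, tag (f x) = tag x) ->
  (forall r : {ffun 'I_N -> E}, exists x, f x != letter r x) ->
  T_sigma sigma (\prod_(x <- enum {: slot}) summand (f x)) = 0.
Proof.
move=> ft fr; rewrite -(big_map f predT summand).
rewrite prod_mwords -map_comp; set ps := map _ (enum _).
have sz1 : size (flatten (map fst ps)) == N.
  rewrite size_flatten /shape sumnE 3!big_map.
  rewrite -hb; apply/eqP; transitivity (\sum_(x <- enum {: slot}) b (tag x))%N.
    by apply: eq_bigr => x _; rewrite size_tuple ft.
  rewrite -(big_slots _ (fun i _ => b i)).
  by apply: eq_bigr => i _; rewrite sum_nat_const card_ord.
have sz2 : size (flatten (map snd ps)) == N.
  rewrite size_flatten /shape sumnE 3!big_map.
  rewrite -ht; apply/eqP; transitivity (\sum_(x <- enum {: slot}) t (tag x))%N.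
    by apply: eq_bigr => x _; rewrite size_tuple ft.
  rewrite -(big_slots _ (fun i _ => t i)).
  by apply: eq_bigr => i _; rewrite sum_nat_const card_ord.
(* All words together have N lower and N upper letters, so both concatenations are functions on N
   positions. *)
pose uf := tnth (Tuple sz1); pose df := tnth (Tuple sz2).
have ufE : flatten (map fst ps) = map uf (enum 'I_N).
  exact: esym (map_tnth_enum (Tuple sz1)).
have dfE : flatten (map snd ps) = map df (enum 'I_N).
  exact: esym (map_tnth_enum (Tuple sz2)).
rewrite (T_sigma_mwords par sigma _ ufE dfE); case: allP => [eqd|_]; last by rewrite mulr0.
pose r := [ffun k => df k].
have uE k : uf k = r (sigma k).
  rewrite ffunE -[in LHS](permK sigma k); apply/esym/eqP.
  by apply: eqd; rewrite mem_enum.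
have [x /negP[]] := fr r; apply/eqP/letter_pair_inj; first by rewrite ft.
pose ps' := [seq letter_pair (letter r x) | x <- enum {: slot}].
(* Lists of words with the same concatenation and the same lengths are equal. *)
have eq1 : map fst ps = map fst ps'.
  apply: eq_from_flatten_shape; first by rewrite ufE flatten_lower; apply: eq_map.
  rewrite /shape -!map_comp; apply: eq_map => y; transitivity (b (tag (f y))).
    exact: size_tuple (tagged (f y)).1.
  by rewrite ft; apply: esym; apply: size_tuple (tagged (letter r y)).1.
have eq2 : map snd ps = map snd ps'.
  apply: eq_from_flatten_shape.
    rewrite dfE flatten_upper.
    by apply: eq_map => k; rewrite ffunE.
  rewrite /shape -!map_comp; apply: eq_map => y; transitivity (t (tag (f y))).
    exact: size_tuple (tagged (f y)).2.
  by rewrite ft; apply: esym; apply: size_tuple (tagged (letter r y)).2.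
have xs : x \in enum {: slot} by rewrite mem_enum.
have /eq_in_map/(_ x xs) e1 : [seq (letter_pair (f x)).1 | x <- enum {: slot}] =
    [seq (letter_pair (letter r x)).1 | x <- enum {: slot}].
  by rewrite (map_comp fst) (map_comp fst (fun x => letter_pair (letter r x))).
have /eq_in_map/(_ x xs) e2 : [seq (letter_pair (f x)).2 | x <- enum {: slot}] =
    [seq (letter_pair (letter r x)).2 | x <- enum {: slot}].
  by rewrite (map_comp snd) (map_comp snd (fun x => letter_pair (letter r x))).
by rewrite [LHS]surjective_pairing [RHS]surjective_pairing; congr pair.
Qed.

Lemma T_sigma_letters (r : {ffun 'I_N -> E}) :
  T_sigma sigma (\prod_(x <- enum {: slot}) summand (letter r x)) =
  (-1) ^+ picture_exponent hb ht sigma r * \prod_(x <- enum {: slot}) w (letter r x).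
Proof.
rewrite -(big_map (letter r) predT summand) prod_mwords -map_comp.
rewrite (T_sigma_mwords par sigma _ (flatten_lower hb ht sigma r) (flatten_upper hb ht sigma r)).
have -> : all (fun k => r k == r (sigma ((sigma^-1)%g k))) (enum 'I_N).
  by apply/allP => k _; rewrite permKV.
rewrite big_map mulr1; apply: mulr_sign_odd.
exact: picture_signs.
Qed.

Lemma T_sigmaS (I : Type) (xs : seq I) (P : pred I) (G : I -> T) :
  T_sigma sigma (\sum_(i <- xs | P i) G i) = \sum_(i <- xs | P i) T_sigma sigma (G i).
Proof.
have T0 : T_sigma sigma (0 : T) = 0.
  by apply: (@addIr _ (T_sigma sigma (0 : T))); rewrite -T_sigmaD !add0r.
exact: (big_morph _ (@T_sigmaD F E par N sigma) T0).
Qed.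

(** Distributing the product gives a sum over choices of a basis vector at each slot; those that
    come from some [r] do so from only one, and the others vanish. *)
Lemma T_sigma_sum_letters :
  T_sigma sigma (\prod_(x <- enum {: slot}) \sum_(c : W | tag c == tag x) summand c) =
  \sum_r (-1) ^+ picture_exponent hb ht sigma r *
     \prod_(x <- enum {: slot}) w (letter r x).
Proof.
rewrite -[in LHS]index_enumE bigA_distr_big_dep T_sigmaS.
pose h r : {ffun slot -> W} := [ffun x => letter r x].
rewrite (bigID (mem [set h r | r : {ffun 'I_N -> E}])) /= [X in _ + X]big1 ?addr0; last first.
  move=> f /andP[/familyP ft /imsetP fr]; rewrite index_enumE.
  apply: T_sigma_choice => [x|r]; first by apply/eqP/ft.
  apply/existsP; rewrite -negb_forall; apply/negP => /forallP fE; apply: fr.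
  by exists r => //; apply/ffunP => x; rewrite ffunE; apply/eqP.
transitivity (\sum_(f in [set h r | r : {ffun 'I_N -> E}])
    T_sigma sigma (\prod_(x <- enum {: slot}) summand (f x))).
  apply: eq_big => [f|f _]; last by rewrite index_enumE.
  rewrite andb_idl // => /imsetP[r _ ->]; apply/familyP => x.
  by rewrite ffunE; apply: eqxx.
rewrite big_imset /= => [|r r' _ _ /ffunP rr']; last first.
  by apply: picture_letter_inj => x _; have := rr' x; rewrite !ffunE.
apply: eq_big => [r|r _]; first by rewrite inE.
by rewrite -T_sigma_letters; congr (T_sigma _ _); apply: eq_bigr => x _; rewrite ffunE.
Qed.

Lemma eval_picture_lift :
  eval_even w (picture_lift m n F hb ht sigma) =
  \sum_r (-1) ^+ picture_exponent hb ht sigma r *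
     \prod_(x <- enum {: slot}) w (letter r x).
Proof.
rewrite eval_even_sum; apply: eq_bigr => r _.
by rewrite eval_evenU wpar_letters big_map mul1r.
Qed.

Lemma mtens_summand (i : 'I_s) :
  mtens par [ffun c => w (@Tagged _ i (fun i => mbasis E (b i) (t i)) c)] =
  \sum_(c : W | tag c == i) summand c.
Proof.
transitivity (\sum_(i' < s | i' == i) \sum_(c : mbasis E (b i') (t i'))
    summand (@Tagged _ i' (fun i => mbasis E (b i) (t i)) c)).
  by rewrite big_pred1_eq; apply: eq_bigr => c _; rewrite ffunE.
rewrite sig_big_dep; apply: eq_big => [c|c _]; first by rewrite andbT.
by case: c.
Qed.

End PictureEvaluation.

(** * Multidegree and restitution of the picture invariant *)

Theorem proposition4p7 (R : realType) (m n s : nat) (b t : 'I_s -> nat)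
    (mult : 'I_s -> nat) (N : nat)
    (ht : (\sum_k mult k * t k)%N = N) (hb : (\sum_k mult k * b k)%N = N)
    (sigma : 'S_N) :
  let phi : symalg R[i] (@Wpar m n s b t) := picture m n R[i] hb ht sigma in
  in_multidegree mult phi /\
  forall w : W0 m n b t R[i],
    restitution (\sum_i mult i)%N phi w =
    T_sigma sigma
      (\prod_(i < s) mtens (@Upar m n) (component w i) ^+ mult i).
Proof.
split=> [|w].
  exists (picture_lift m n R[i] hb ht sigma); last exact: to_sym_picture_lift.
  exact: picture_lift_multidegree.
rewrite -to_sym_picture_lift restitution_to_sym; last exact: picture_lift_tdeg.
(* Both sides equal the same signed sum over r_1, ..., r_N, so only the argument of [T_sigma]
   remains to be identified. *)
rewrite eval_picture_lift -(T_sigma_sum_letters hb ht sigma (valP w)).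
congr (T_sigma _ _); apply: esym.
(* Each power becomes a product over its copies, which the slots index in the same order. *)
transitivity (\prod_(i < s) \prod_(j < mult i) mtens (@Upar m n) (component w i)).
  by apply: eq_bigr => i _; rewrite prodr_const card_ord.
rewrite (big_slots *%R (fun i _ => mtens (@Upar m n) (component w i))).
by apply: eq_bigr => x _; apply: mtens_summand.
Qed.
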